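(* Let $\mathcal{T}$ be a compactly generated triangulated category, let $\mathbb{T}$ be a t-structure in $\mathcal{T}$ with heart $\mathcal{H}_{\mathbb{T}}$, and assume there is a projective generator $P$ of $\mathcal{H}_{\mathbb{T}}$. Assume further that $\mathrm{Def}_{\mathcal{T}}(P)\subseteq \mathcal{H}_{\mathbb{T}}$, and let $\mathfrak{S}=\mathrm{End}_{\mathcal{T}}(P)$ be endowed with the compact topology. Then $\mathfrak{S}$ is complete and separated, and there is an equivalence of abelian categories $\mathrm{Hom}_{\mathcal{H}_{\mathbb{T}}}(P,-):\mathcal{H}_{\mathbb{T}}\xrightarrow{\cong}\mathrm{Ctra}\text{-}\mathfrak{S}$.
   Context: Compactly generated triangulated category: $\mathcal{T}$ has arbitrary coproducts, the full subcategory $\mathcal{T}^{\mathsf c}$ of compact objects (those $F$ for which $\mathrm{Hom}_{\mathcal{T}}(F,-)$ preserves coproducts) is skeletally small, and any $X$ with $\mathrm{Hom}_{\mathcal{T}}(F,X)=0$ for all $F\in\mathcal{T}^{\mathsf c}$ is zero. t-structure: a pair $\mathbb{T}=(\mathcal{U},\mathcal{V})$ of full subcategories with $\mathcal{V}=\{X\mid \mathrm{Hom}_{\mathcal{T}}(U,X)=0\ \forall U\in\mathcal{U}\}$, $\mathcal{U}[1]\subseteq\mathcal{U}$, and such that each $X\in\mathcal{T}$ fits into a triangle $U\to X\to V\to U[1]$ with $U\in\mathcal{U}$, $V\in\mathcal{V}$. Its heart is the abelian category $\mathcal{H}_{\mathbb{T}}=\mathcal{U}\cap\mathcal{V}[1]$.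 Definable: a subcategory of $\mathcal{T}$ is definable if it is of the form $\{X\in\mathcal{T}\mid \mathrm{Hom}_{\mathcal{T}}(f,X)=0\ \forall f\in\Phi\}$ for a set $\Phi$ of maps in $\mathcal{T}^{\mathsf c}$. $\mathrm{Def}_{\mathcal{T}}(X)$ is the smallest definable subcategory containing $X$. Compact topology: for $M\in\mathcal{T}$, the ring $\mathrm{End}_{\mathcal{T}}(M)$ has the linear topology with base of open left ideals $\mathfrak{I}_f=\{g\in\mathrm{End}_{\mathcal{T}}(M)\mid g\circ f=0\}$, where $f$ runs over all maps $f:F\to M$ with $F\in\mathcal{T}^{\mathsf c}$. Topological rings and contramodules: a (left) topological ring is a unital associative ring $\mathfrak{R}$ with a filter of left ideals (the open left ideals) such that for each $r\in\mathfrak{R}$ and open $\mathfrak{I}$ there is an open $\mathfrak{I}'$ with $\mathfrak{I}'r\subseteq\mathfrak{I}$. It is complete (resp. separated) if the canonical map $\mathfrak{R}\to\varprojlim_{\mathfrak{I}\text{ open}}\mathfrak{R}/\mathfrak{I}$ is surjective (resp. injective). For $\mathfrak{R}$ complete and separated and a set $X$, let $\mathfrak{R}[[X]]$ be the set of all formal linear combinations $\sum_{x\in X}x\cdot r_x$ with $r_x\in\mathfrak{R}$ such that each open left ideal contains all but finitely many $r_x$. With the obvious functoriality, the ''opening of parentheses'' maps $\mu_X:\mathfrak{R}[[\mathfrak{R}[[X]]]]\to\mathfrak{R}[[X]]$ and the ''trivial linear combination'' maps $\epsilon_X:X\to\mathfrak{R}[[X]]$, this is a monad on sets. A right $\mathfrak{R}$-contramodule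 is a module (= algebra) over this monad; $\mathrm{Ctra}\text{-}\mathfrak{R}$ denotes the (abelian) category of right $\mathfrak{R}$-contramodules. The group $\mathrm{Hom}_{\mathcal{H}_{\mathbb{T}}}(P,X)$ is regarded as a right $\mathfrak{S}$-contramodule by means of the identification of $\mathfrak{S}[[Z]]$ with $\mathrm{Hom}(P,P^{(Z)})$ (for sets $Z$) sending a morphism to its family of coordinates: an element of $\mathfrak{S}[[Z]]$ with $Z=\mathrm{Hom}(P,X)$ corresponds to a morphism $P\to P^{(Z)}$, and the contraaction sends it to the composite with the evaluation map $P^{(Z)}\to X$. *)

(* Defs.v *)
From HB Require Import structures.
From mathcomp Require Import all_boot all_algebra.
From mathcomp Require Import mathcomp_extra boolp classical_sets functions.
From mathcomp Require Import cardinality fsbigop.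

Set Implicit Arguments.
Unset Strict Implicit.
Unset Printing Implicit Defensive.

Import GRing.Theory.
Local Open Scope classical_set_scope.
Local Open Scope ring_scope.

(* The universe of "sets": hom-sets, index sets of coproducts and underlying
   sets of contramodules all live in the universe of the carriers of zmodType,
   whereas a category may have a larger type (a class) of objects. *)
Definition small := Type@{Algebra.Zmodule.axioms_.u0}.

Reserved Notation "g ∘ f" (at level 40, left associativity).

Record category := Category {
  obj :> Type;
  Mor : obj -> obj -> small;
  idm : forall X, Mor X X;
  compose : forall X Y Z, Mor Y Z -> Mor X Y -> Mor X Z;
  compose_idl : forall X Y (f : Mor X Y), compose (idm Y) f = f;
  compose_idr : forall X Y (f : Mor X Y), compose f (idm X) = f;
  composeA : forall X Y Z W (h : Mor Z W) (g : Mor Y Z) (f : Mor X Y),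
    compose h (compose g f) = compose (compose h g) f }.

Arguments idm {c} X.
Notation "g ∘ f" := (compose g f).

Section CategoryTheory.
Variable C : category.
Implicit Types X Y Z : C.

Definition is_iso X Y (f : Mor X Y) :=
  exists g : Mor Y X, g ∘ f = idm X /\ f ∘ g = idm Y.
Definition isomorphic X Y := exists f : Mor X Y, is_iso f.

Definition monomorphism X Y (f : Mor X Y) :=
  forall Z (a b : Mor Z X), f ∘ a = f ∘ b -> a = b.
Definition epimorphism X Y (f : Mor X Y) :=
  forall Z (a b : Mor Y Z), a ∘ f = b ∘ f -> a = b.

Definition is_zero_object Z :=
  (forall X, exists! f : Mor Z X, True) /\ (forall X, exists! f : Mor X Z, True).
Definition is_zero_morphism X Y (f : Mor X Y) :=
  exists Z, is_zero_object Z /\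
    exists (a : Mor X Z) (b : Mor Z Y), f = b ∘ a.

Definition is_kernel K X Y (f : Mor X Y) (k : Mor K X) :=
  is_zero_morphism (f ∘ k) /\
  forall W (a : Mor W X), is_zero_morphism (f ∘ a) -> exists! b, k ∘ b = a.
Definition is_cokernel X Y Q (f : Mor X Y) (q : Mor Y Q) :=
  is_zero_morphism (q ∘ f) /\
  forall W (a : Mor Y W), is_zero_morphism (a ∘ f) -> exists! b, b ∘ q = a.

Definition is_product X Y B (p : Mor B X) (q : Mor B Y) :=
  forall W (a : Mor W X) (b : Mor W Y), exists! c, p ∘ c = a /\ q ∘ c = b.
Definition is_binary_coproduct X Y B (i : Mor X B) (j : Mor Y B) :=
  forall W (a : Mor X W) (b : Mor Y W), exists! c, c ∘ i = a /\ c ∘ j = b.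

(* Freyd's axioms; they need no addition of morphisms, which is determined by the
   finite products and coproducts. *)
Definition abelian_category :=
  (exists Z, is_zero_object Z) /\
  (forall X Y, exists B (p : Mor B X) (q : Mor B Y), is_product p q) /\
  (forall X Y, exists B (i : Mor X B) (j : Mor Y B), is_binary_coproduct i j) /\
  (forall X Y (f : Mor X Y), exists K (k : Mor K X), is_kernel f k) /\
  (forall X Y (f : Mor X Y), exists Q (q : Mor Y Q), is_cokernel f q) /\
  (forall X Y (f : Mor X Y), monomorphism f ->
    exists Z (g : Mor Y Z), is_kernel g f) /\
  (forall X Y (f : Mor X Y), epimorphism f ->
    exists Z (g : Mor Z X), is_cokernel g f).

Definition is_projective P :=
  forall X Y (e : Mor X Y) (f : Mor P Y), epimorphism e -> exists g, e ∘ g = f.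
Definition is_generator P :=
  forall X Y (f g : Mor X Y), (forall h : Mor P X, f ∘ h = g ∘ h) -> f = g.
Definition is_projective_generator P := is_projective P /\ is_generator P.

Record coproduct (I : small) (X : I -> C) := Coproduct {
  cp_obj :> C;
  cp_inj : forall i, Mor (X i) cp_obj;
  cp_case : forall Y, (forall i, Mor (X i) Y) -> Mor cp_obj Y;
  cp_caseK : forall Y (f : forall i, Mor (X i) Y) i, cp_case f ∘ cp_inj i = f i;
  cp_case_uniq : forall Y (f : forall i, Mor (X i) Y) (g : Mor cp_obj Y),
    (forall i, g ∘ cp_inj i = f i) -> g = cp_case f }.

Definition has_coproducts := forall (I : small) (X : I -> C), coproduct X.

End CategoryTheory.

Definition full_subcategory (C : category) (D : C -> Prop) : category := {|
  obj := {X : C | D X};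
  Mor X Y := Mor (sval X) (sval Y);
  idm X := idm (sval X);
  compose X Y Z g f := g ∘ f;
  compose_idl X Y f := compose_idl f;
  compose_idr X Y f := compose_idr f;
  composeA X Y Z W h g f := composeA h g f |}.

Record functor (C D : category) := Functor {
  fobj :> C -> D;
  fmap : forall X Y, Mor X Y -> Mor (fobj X) (fobj Y);
  fmap_id : forall X, fmap (idm X) = idm (fobj X);
  fmap_comp : forall X Y Z (g : Mor Y Z) (f : Mor X Y),
    fmap (g ∘ f) = fmap g ∘ fmap f }.

(* The naturally isomorphic functors are given by their actions on objects and
   morphisms, so that composites and identities need not be packaged. *)
Definition naturally_isomorphic (C D : category) (F G : C -> D)
    (F1 : forall X Y, Mor X Y -> Mor (F X) (F Y))
    (G1 : forall X Y, Mor X Y -> Mor (G X) (G Y)) :=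
  exists t : forall X, Mor (F X) (G X), (forall X, is_iso (t X)) /\
    forall X Y (f : Mor X Y), t Y ∘ F1 X Y f = G1 X Y f ∘ t X.

Definition is_equivalence (C D : category) (F : functor C D) :=
  exists G : functor D C,
    naturally_isomorphic (fun X Y f => fmap G (@fmap _ _ F X Y f))
                         (fun X Y f => f) /\
    naturally_isomorphic (fun X Y f => fmap F (@fmap _ _ G X Y f))
                         (fun X Y f => f).

Record zmod_category := ZmodCategory {
  zmod_cat :> category;
  hom_zmod : forall X Y : zmod_cat, GRing.Zmodule (Mor X Y) }.

HB.instance Definition _ (T : zmod_category) (X Y : T) := @hom_zmod T X Y.

Record additive_category := AdditiveCategory {
  additive_zmod_cat :> zmod_category;
  composeDl : forall (X Y Z : additive_zmod_cat) (g g' : Mor Y Z) (f : Mor X Y),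
    (g + g') ∘ f = g ∘ f + g' ∘ f;
  composeDr : forall (X Y Z : additive_zmod_cat) (g : Mor Y Z) (f f' : Mor X Y),
    g ∘ (f + f') = g ∘ f + g ∘ f';
  zero_object : exists Z : additive_zmod_cat, idm Z = 0;
  biproducts : forall X Y : additive_zmod_cat,
    exists (B : additive_zmod_cat) (i : Mor X B) (j : Mor Y B)
      (p : Mor B X) (q : Mor B Y),
      p ∘ i = idm X /\ q ∘ j = idm Y /\ p ∘ j = 0 /\ q ∘ i = 0 /\
      i ∘ p + j ∘ q = idm B }.

Record triangulated_category := TriangulatedCategory {
  tri_cat :> additive_category;
  shift_functor : functor tri_cat tri_cat;
  shift_equiv : is_equivalence shift_functor;
  shiftD : forall (X Y : tri_cat) (f g : Mor X Y),
    fmap shift_functor (f + g) = fmap shift_functor f + fmap shift_functor g;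
  (* [triangle f g h]: X -f-> Y -g-> Z -h-> X[1] is distinguished. *)
  triangle : forall X Y Z : tri_cat,
    Mor X Y -> Mor Y Z -> Mor Z (shift_functor X) -> Prop;
  triangle_iso : forall (X Y Z X' Y' Z' : tri_cat)
      (f : Mor X Y) (g : Mor Y Z) (h : Mor Z (shift_functor X))
      (f' : Mor X' Y') (g' : Mor Y' Z') (h' : Mor Z' (shift_functor X'))
      (a : Mor X X') (b : Mor Y Y') (c : Mor Z Z'),
    is_iso a -> is_iso b -> is_iso c ->
    b ∘ f = f' ∘ a -> c ∘ g = g' ∘ b -> fmap shift_functor a ∘ h = h' ∘ c ->
    triangle f g h -> triangle f' g' h';
  triangle_id : forall X Z : tri_cat, idm Z = 0 ->
    triangle (idm X) (0 : Mor X Z) (0 : Mor Z (shift_functor X));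
  triangle_cone : forall (X Y : tri_cat) (f : Mor X Y),
    exists (Z : tri_cat) (g : Mor Y Z) (h : Mor Z (shift_functor X)), triangle f g h;
  triangle_rot : forall (X Y Z : tri_cat)
      (f : Mor X Y) (g : Mor Y Z) (h : Mor Z (shift_functor X)),
    triangle f g h <-> triangle g h (- fmap shift_functor f);
  triangle_mor : forall (X Y Z X' Y' Z' : tri_cat)
      (f : Mor X Y) (g : Mor Y Z) (h : Mor Z (shift_functor X))
      (f' : Mor X' Y') (g' : Mor Y' Z') (h' : Mor Z' (shift_functor X'))
      (a : Mor X X') (b : Mor Y Y'),
    triangle f g h -> triangle f' g' h' -> b ∘ f = f' ∘ a ->
    exists c : Mor Z Z', c ∘ g = g' ∘ b /\ fmap shift_functor a ∘ h = h' ∘ c;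
  triangle_octa : forall (X Y Z Q1 Q2 Q3 : tri_cat)
      (f : Mor X Y) (g : Mor Y Z)
      (p1 : Mor Y Q1) (d1 : Mor Q1 (shift_functor X))
      (p2 : Mor Z Q2) (d2 : Mor Q2 (shift_functor X))
      (p3 : Mor Z Q3) (d3 : Mor Q3 (shift_functor Y)),
    triangle f p1 d1 -> triangle (g ∘ f) p2 d2 -> triangle g p3 d3 ->
    exists (a : Mor Q1 Q2) (b : Mor Q2 Q3),
      triangle a b (fmap shift_functor p1 ∘ d3) /\
      a ∘ p1 = p2 ∘ g /\ d2 ∘ a = d1 /\
      b ∘ p2 = p3 /\ d3 ∘ b = fmap shift_functor f ∘ d2 }.

Section Compact.
Variable T : additive_category.

(* Mor(F, -) : T -> Ab sends every coproduct in T to a coproduct in Ab. *)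
Definition compact_object (F : T) :=
  forall (I : small) (X : I -> T) (C : coproduct X)
    (A : zmodType) (a : forall i, {additive Mor F (X i) -> A}),
  exists b : {additive Mor F C -> A},
    (forall i (g : Mor F (X i)), b (cp_inj C i ∘ g) = a i g) /\
    forall b' : {additive Mor F C -> A},
      (forall i (g : Mor F (X i)), b' (cp_inj C i ∘ g) = a i g) -> b' =1 b.

Definition skeletally_small (D : T -> Prop) :=
  exists (I : small) (F : I -> T),
    forall X, D X -> exists i, isomorphic X (F i).

(* The existence of coproducts is the separate datum [has_coproducts T]. *)
Definition compactly_generated :=
  skeletally_small compact_object /\
  forall X : T, (forall F, compact_object F -> forall f : Mor F X, f = 0) ->
    idm X = 0.

Definition definable (D : T -> Prop) :=
  exists (I : small) (F G : I -> T) (f : forall i, Mor (F i) (G i)),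
    (forall i, compact_object (F i) /\ compact_object (G i)) /\
    forall X, D X <-> forall i (h : Mor (G i) X), h ∘ f i = 0.

Definition Def (X Y : T) : Prop := forall D, definable D -> D X -> D Y.

End Compact.

Record t_structure (T : triangulated_category) := TStructure {
  aisle : T -> Prop;
  coaisle : T -> Prop;
  coaisleP : forall X : T,
    coaisle X <-> forall (U : T) (f : Mor U X), aisle U -> f = 0;
  aisle_shift : forall U : T, aisle U -> aisle (shift_functor T U);
  t_triangle : forall X : T, exists (U V : T)
      (f : Mor U X) (g : Mor X V) (h : Mor V (shift_functor T U)),
    aisle U /\ coaisle V /\ triangle f g h }.

Definition in_heart (T : triangulated_category) (t : t_structure T) (X : T) : Prop :=
  aisle t X /\ exists V, coaisle t V /\ isomorphic X (shift_functor T V).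

Definition heart (T : triangulated_category) (t : t_structure T) : category :=
  full_subcategory (in_heart t).

Definition left_ideal (R : pzRingType) (I : set R) :=
  I 0 /\ (forall x y, I x -> I y -> I (x + y)) /\
  (forall r x, I x -> I (r * x)).

Record topRing := TopRing {
  topRing_ring :> pzRingType;
  open_ideal : set (set topRing_ring);
  open_left_ideal : forall I, open_ideal I -> left_ideal I;
  open_ideal_ex : exists I, open_ideal I;
  open_idealI : forall I J, open_ideal I -> open_ideal J ->
    open_ideal (I `&` J);
  open_idealS : forall I J, open_ideal I -> left_ideal J -> I `<=` J ->
    open_ideal J;
  open_idealM : forall (r : topRing_ring) I, open_ideal I ->
    exists J, open_ideal J /\ forall s, J s -> I (s * r) }.

Section Completeness.
Variable R : topRing.

Definition residue_class (r : R) (I : set R) : set R := [set s | I (s - r)].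

(* The elements of the limit of the R/I over the open left ideals I. *)
Definition compatible_classes (c : set R -> set R) :=
  (forall I, open_ideal I -> exists r, c I = residue_class r I) /\
  (forall I J, open_ideal I -> open_ideal J -> J `<=` I -> c J `<=` c I).

Definition complete_ring := forall c, compatible_classes c ->
  exists r, forall I, open_ideal I -> residue_class r I = c I.
Definition separated_ring := forall r s : R,
  (forall I, open_ideal I -> residue_class r I = residue_class s I) -> r = s.

Definition zero_convergent (X : Type) (r : X -> R) :=
  forall I, open_ideal I -> finite_set [set x | ~ I (r x)].

(* s is the element of the limit of the R/I given by the (finite) sums of the
   r x modulo I. *)
Definition is_sum (X : Type) (r : X -> R) (s : R) :=
  forall I, open_ideal I ->
    I (s - \sum_(x \in ([set x | ~ I (r x)] : set {classic X})) r x).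

Definition csum (X : Type) (r : X -> R) : R := xget 0 [set s | is_sum r s].

End Completeness.

Record complete_topRing := CompleteTopRing {
  complete_topRing_top :> topRing;
  complete_separated :
    complete_ring complete_topRing_top /\ separated_ring complete_topRing_top }.

Section LeftIdeal.
Variables (R : topRing) (I : set R).
Hypothesis Iop : open_ideal I.

Lemma ideal0 : I 0. Proof. by case: (open_left_ideal Iop). Qed.
Lemma idealD x y : I x -> I y -> I (x + y).
Proof. by case: (open_left_ideal Iop) => _ [h _]; apply: h. Qed.
Lemma idealMl r x : I x -> I (r * x).
Proof. by case: (open_left_ideal Iop) => _ [_ h]; apply: h. Qed.
Lemma idealN x : I x -> I (- x).
Proof. by move=> /(idealMl (-1)); rewrite mulN1r. Qed.
Lemma idealB x y : I x -> I y -> I (x - y).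
Proof. by move=> Ix /idealN; apply: idealD. Qed.
Lemma ideal_trans y x z : I (x - y) -> I (y - z) -> I (x - z).
Proof. by move=> /idealD h /h; rewrite addrA subrK. Qed.
Lemma ideal_sum (J : choiceType) (A : set J) (r : J -> R) :
  finite_set A -> (forall x, A x -> I (r x)) -> I (\sum_(x \in A) r x).
Proof.
move=> fA Ar; rewrite fsbig_finite //= big_seq_cond.
apply: (big_ind I); [exact: ideal0 | exact: idealD |].
by move=> x /andP[]; rewrite in_fset_set // inE => /Ar.
Qed.
Lemma ideal_sumB (J : choiceType) (A : set J) (r s : J -> R) :
  finite_set A -> (forall x, A x -> I (r x - s x)) ->
  I (\sum_(x \in A) r x - \sum_(x \in A) s x).
Proof.
move=> fA Ars; rewrite !fsbig_finite //= -sumrB big_seq_cond.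
apply: (big_ind I); [exact: ideal0 | exact: idealD |].
by move=> x /andP[]; rewrite in_fset_set // inE => /Ars.
Qed.
Lemma ideal_widen (X : Type) (r : X -> R) (A B : set {classic X}) :
  finite_set B -> A `<=` B -> (forall x, B x -> ~ A x -> I (r x)) ->
  I (\sum_(x \in A) r x - \sum_(x \in B) r x).
Proof.
move=> fB AB Br; rewrite (fsbigID A B) //= (setIidr AB).
rewrite opprD addNKr; apply: idealN; apply: ideal_sum.
  exact: finite_setIl.
by move=> x [Bx nAx]; apply: Br.
Qed.
Lemma residue_class_eq r s : I (r - s) -> residue_class r I = residue_class s I.
Proof.
move=> Irs; apply/seteqP; split=> x /=.
  by move=> /ideal_trans; apply.
by move=> /ideal_trans; apply; rewrite -opprB; apply: idealN.
Qed.
Lemma is_sum_mod (X : Type) (r : X -> R) s (B : set {classic X}) :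
  is_sum r s -> finite_set B -> (forall x, ~ B x -> I (r x)) ->
  I (s - \sum_(x \in B) r x).
Proof.
move=> rs fB Br; apply: (ideal_trans (rs I Iop)); apply: ideal_widen => //.
  by move=> x /= nIx; apply: contrapT => /Br.
by move=> x _ /contrapT.
Qed.
End LeftIdeal.

Section Sums.
Variable R : complete_topRing.

Lemma ideal_separated (r s : R) : (forall I, open_ideal I -> I (r - s)) -> r = s.
Proof.
move=> rs; have [_ sepR] := complete_separated R.
by apply: sepR => I Iop; apply: residue_class_eq => //; apply: rs.
Qed.

Lemma csumP (X : Type) (r : X -> R) : zero_convergent r -> is_sum r (csum r).
Proof.
move=> r0; rewrite /csum; apply: (@xgetPex _ 0 [set s | is_sum r s]).
have [complR _] := complete_separated R.
have [|s sE] := complR (fun I => residue_class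
    (\sum_(x \in ([set x | ~ I (r x)] : set {classic X})) r x) I).
  split=> [I Iop|I J Iop Jop JI x /= xJ]; first by eexists.
  apply: (ideal_trans Iop) (JI _ xJ) _; rewrite -opprB; apply: idealN => //.
  apply: ideal_widen => //; first exact: r0.
    by move=> y /= nIy /JI.
  by move=> y _ /contrapT.
exists s => I Iop /=; have := sE I Iop => /seteqP[+ _] => /(_ s); apply.
by rewrite /residue_class /= subrr; apply: ideal0.
Qed.

Lemma ideal_csum (X : Type) (r : X -> R) I : zero_convergent r ->
  open_ideal I -> (forall x, I (r x)) -> I (csum r).
Proof.
move=> /csumP rs Iop Ir; have := is_sum_mod Iop (B := set0) rs.
by rewrite fsbig_set0 subr0; apply.
Qed.

(* R[[X]]: the formal linear combination of the x with coefficients r x. *)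
Record lincomb (X : Type) := Lincomb {
  coef :> X -> R;
  coef_convergent : zero_convergent coef }.

Lemma lincomb_inj (X : Type) (r s : lincomb X) : r =1 s -> r = s.
Proof.
case: r s => [r r0] [s s0] /= /funext rs; case: s / rs s0 => s0.
by congr Lincomb; exact: Prop_irrelevance.
Qed.

Definition restrict_coef (X : Type) (D : set X) (r : X -> R) (x : X) : R :=
  if `[< D x >] then r x else 0.

Lemma restrict_coef_convergent (X : Type) D (r : X -> R) :
  zero_convergent r -> zero_convergent (restrict_coef D r).
Proof.
move=> r0 I Iop; apply: sub_finite_set (r0 I Iop) => x /=.
by rewrite /restrict_coef; case: asboolP => // _ []; apply: ideal0.
Qed.

Section Functoriality.
Variables (X Y : Type) (f : X -> Y).

Definition push (r : X -> R) (y : Y) : R := csum (restrict_coef (f @^-1` [set y]) r).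

Lemma push_convergent r : zero_convergent r -> zero_convergent (push r).
Proof.
move=> r0 I Iop; apply: sub_finite_set (finite_image f (r0 I Iop)) => y /= nIy.
apply: contrapT => ny; apply: nIy; apply: ideal_csum => //.
  exact: restrict_coef_convergent.
move=> x; rewrite /restrict_coef; case: asboolP => [/= fxy|_]; last exact: ideal0.
by apply: contrapT => nIx; apply: ny; exists x.
Qed.

Definition lincomb_map (r : lincomb X) : lincomb Y :=
  Lincomb (push_convergent (coef_convergent r)).

End Functoriality.

Section Unit.
Variables (X : Type) (x : X).
Definition single (y : X) : R := if `[< y = x >] then 1 else 0.

Lemma single_convergent : zero_convergent single.
Proof.
move=> I Iop; apply: sub_finite_set (finite_set1 x) => y /=.
by rewrite /single; case: asboolP => // _ []; apply: ideal0.
Qed.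

Definition lincomb_unit : lincomb X := Lincomb single_convergent.
End Unit.

Section Multiplication.
Variables (X : Type) (w : lincomb (lincomb X)).

Lemma mulw_convergent x : zero_convergent (fun r : lincomb X => r x * w r).
Proof.
move=> I Iop; apply: sub_finite_set (coef_convergent w Iop) => r /=.
by move=> nI /(idealMl Iop (r x)).
Qed.

(* If w is the sum of the (r * w_r) with r the sum of the (x * r_x), then the
   coefficient of x is the sum over r of the r_x w_r. *)
Definition open_parentheses (x : X) : R := csum (fun r : lincomb X => r x * w r).

Lemma open_parentheses_convergent : zero_convergent open_parentheses.
Proof.
move=> I Iop; pose B : set (lincomb X) := [set r | ~ I (w r)].
have := @bigcup_finite _ _ B (fun r => [set x | ~ I (r x * w r)]).
move=> /(_ (coef_convergent w Iop)) fU; apply: sub_finite_set (fU _) => [x /= nIx|r _].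
  apply: contrapT => nU; apply: nIx; apply: ideal_csum => //.
    exact: mulw_convergent.
  move=> r; apply: contrapT => nI; apply: nU; exists r => //= Iw.
  by apply: nI; apply: idealMl.
have [J [Jop JI]] := open_idealM (w r) Iop.
by apply: sub_finite_set (coef_convergent r Jop) => x /= nI /JI.
Qed.

Definition lincomb_mul : lincomb X := Lincomb open_parentheses_convergent.
End Multiplication.

Lemma lincomb_map_id (X : Type) (r : lincomb X) : lincomb_map id r = r.
Proof.
apply: lincomb_inj => y /=; apply: ideal_separated => I Iop.
have rs := csumP (restrict_coef_convergent (id @^-1` [set y]) (coef_convergent r)).
have := is_sum_mod Iop (B := [set y]) rs (finite_set1 _).
have rE : restrict_coef (id @^-1` [set y]) r y = r y by rewrite /restrict_coef asboolT.
rewrite fsbig_set1 rE; apply=> x xy.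
by rewrite /restrict_coef asboolF //; apply: ideal0.
Qed.

Lemma lincomb_map_comp (X Y Z : Type) (g : Y -> Z) (f : X -> Y) (r : lincomb X) :
  lincomb_map (g \o f) r = lincomb_map g (lincomb_map f r).
Proof.
apply: lincomb_inj => z /=; apply: ideal_separated => I Iop.
pose A : set {classic X} := [set x | ~ I (r x)].
have fA : finite_set A by exact: (coef_convergent r Iop).
pose B : set {classic Y} := (f : {classic X} -> {classic Y}) @` A.
have fB : finite_set B by exact: finite_image.
have r0 := coef_convergent r.
have h1 := is_sum_mod Iop (B := A)
  (csumP (restrict_coef_convergent ((g \o f) @^-1` [set z]) r0)) fA.
have {}h1 := h1 _; apply: (ideal_trans Iop (h1 _)).
  move=> x nAx; rewrite /restrict_coef; case: asboolP => _; last exact: ideal0.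
  exact: contrapT.
have h2 := is_sum_mod Iop (B := B)
  (csumP (restrict_coef_convergent (g @^-1` [set z]) (push_convergent f r0))) fB.
rewrite -opprB; apply: idealN => //; apply: (ideal_trans Iop (h2 _)).
  move=> y nBy; rewrite /restrict_coef; case: asboolP => _; last exact: ideal0.
  apply: ideal_csum => // [|x]; first exact: restrict_coef_convergent.
  rewrite /restrict_coef; case: asboolP => [/= fxy|_]; last exact: ideal0.
  by apply: contrapT => nIx; apply: nBy; exists x.
have -> : \sum_(x \in A) restrict_coef ((g \o f) @^-1` [set z]) r x =
    \sum_(y \in B) \sum_(x \in A) restrict_coef (g @^-1` [set z])
      (fun y => restrict_coef (f @^-1` [set y]) r x) y.
  rewrite exchange_fsbig //; apply: eq_fsbigr => x /set_mem Ax.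
  rewrite (fsbigD1 (f x : {classic Y})) //=; last by exists x.
  rewrite fsbig1 => [|y [_ /= yfx]].
    by rewrite addr0 /restrict_coef /=; case: asboolP => //= _; rewrite asboolT.
  rewrite /restrict_coef; case: asboolP => //= _; rewrite asboolF //.
  by move=> fxy; apply: yfx.
apply: ideal_sumB => // y _; rewrite {1}/restrict_coef; case: asboolP => gy.
  apply: (ideal_trans Iop)
    (is_sum_mod Iop (csumP (restrict_coef_convergent (f @^-1` [set y]) r0)) fA _) _.
    move=> x nAx; rewrite /restrict_coef; case: asboolP => _; last exact: ideal0.
    exact: contrapT.
  apply: ideal_sumB => // x _; rewrite [in X in _ - X]/restrict_coef asboolT // subrr.
  exact: ideal0.
rewrite sub0r; apply: idealN => //; apply: ideal_sum => // x _.
by rewrite /restrict_coef asboolF //; apply: ideal0.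
Qed.
End Sums.

(* Right contramodules: the algebras over the monad R[[-]] on small sets. *)
Section Contramodules.
Variable R : complete_topRing.

Definition contramodule_laws (C : Type) (act : lincomb R C -> C) :=
  (forall c, act (lincomb_unit R c) = c) /\
  (forall w, act (lincomb_mul w) = act (lincomb_map act w)).

Record contramodule := Contramodule {
  contra_set :> Type@{Algebra.Zmodule.axioms_.u0};
  contraact : lincomb R contra_set -> contra_set;
  contraactP : contramodule_laws contraact }.

Definition contra_morphism (C D : contramodule) (f : C -> D) :=
  forall u, f (contraact u) = contraact (lincomb_map f u).

Definition contra_hom (C D : contramodule) := {f : C -> D | contra_morphism f}.

Lemma contra_morphism_id (C : contramodule) : @contra_morphism C C id.
Proof. by move=> u; rewrite lincomb_map_id. Qed.

Lemma contra_morphism_comp (C D E : contramodule) (g : D -> E) (f : C -> D) :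
  contra_morphism g -> contra_morphism f -> contra_morphism (g \o f).
Proof. by move=> gP fP u; rewrite /= fP gP lincomb_map_comp. Qed.

Lemma contra_hom_inj (C D : contramodule) (f g : contra_hom C D) :
  sval f = sval g -> f = g.
Proof. by case: f g => [f fP] [g gP] /= fg; apply: eq_exist. Qed.

Definition contra_id (C : contramodule) : contra_hom C C :=
  exist _ id (@contra_morphism_id C).
Definition contra_comp (C D E : contramodule) (g : contra_hom D E)
    (f : contra_hom C D) : contra_hom C E :=
  exist _ (sval g \o sval f) (contra_morphism_comp (svalP g) (svalP f)).

Definition Ctra : category := {|
  obj := contramodule;
  Mor := contra_hom;
  idm := contra_id;
  compose := contra_comp;
  compose_idl C D f := @contra_hom_inj C D (contra_comp (contra_id D) f) f erefl;
  compose_idr C D f := @contra_hom_inj C D (contra_comp f (contra_id C)) f erefl;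
  composeA C D E F h g f := @contra_hom_inj C F
    (contra_comp h (contra_comp g f)) (contra_comp (contra_comp h g) f) erefl |}.

End Contramodules.

Section CompactTopology.
Variable T : additive_category.

Lemma compose0l (X Y Z : T) (f : Mor X Y) : (0 : Mor Y Z) ∘ f = 0.
Proof. by apply: (addrI (0 ∘ f)); rewrite -composeDl !addr0. Qed.
Lemma compose0r (X Y Z : T) (g : Mor Y Z) : g ∘ (0 : Mor X Y) = 0.
Proof. by apply: (addrI (g ∘ 0)); rewrite -composeDr !addr0. Qed.

Lemma hom_from0 (X Y : T) (f : Mor X Y) : idm X = 0 -> f = 0.
Proof. by move=> X0; rewrite -[f]compose_idr X0 compose0r. Qed.

Lemma compact0 (Z : T) : idm Z = 0 -> compact_object Z.
Proof.
move=> Z0 I X C A a; exists (\0 : {additive Mor Z C -> A}).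
have b0 X' (b : {additive Mor Z X' -> A}) g : b g = 0.
  by rewrite (hom_from0 g Z0) raddf0.
by split=> [i g|b' _ g]; rewrite ?b0.
Qed.

Lemma composeBl (X Y Z : T) (g g' : Mor Y Z) (f : Mor X Y) :
  (g - g') ∘ f = g ∘ f - g' ∘ f.
Proof. by apply: (addIr (g' ∘ f)); rewrite -composeDl !subrK. Qed.

Section Precompose.
Variables (X Y Z : T) (A : zmodType) (r : Mor X Y) (h : {additive Mor X Z -> A}).
Definition precompose (g : Mor Y Z) : A := h (g ∘ r).
Lemma precompose_additive : zmod_morphism precompose.
Proof. by move=> g g'; rewrite /precompose composeBl raddfB. Qed.
HB.instance Definition _ := GRing.isZmodMorphism.Build (Mor Y Z) A precompose
  precompose_additive.
End Precompose.

Lemma compact_biproduct (F G B : T) (i : Mor F B) (j : Mor G B) (p : Mor B F)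
    (q : Mor B G) : i ∘ p + j ∘ q = idm B ->
  compact_object F -> compact_object G -> compact_object B.
Proof.
move=> ijpq cF cG I X C A a.
have splitB D (h : {additive Mor B D -> A}) (g : Mor B D) :
    h g = h (g ∘ i ∘ p) + h (g ∘ j ∘ q).
  by rewrite -raddfD -!composeA -composeDr ijpq compose_idr.
have [bF [bFE bFu]] := cF I X C A (fun k => precompose p (a k)).
have [bG [bGE bGu]] := cG I X C A (fun k => precompose q (a k)).
exists (precompose i bF \+ precompose j bG : {additive Mor B C -> A}).
split=> [k g|b' b'E g] /=; rewrite /precompose.
  by rewrite -!composeA bFE bGE /= /precompose -splitB.
have pE : precompose p b' =1 bF.
  by apply: bFu => k f; rewrite /= /precompose -composeA b'E.
have qE : precompose q b' =1 bG.
  by apply: bGu => k f; rewrite /= /precompose -composeA b'E.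
by rewrite splitB -pE -qE.
Qed.

Variable M : T.

Definition endo := Mor M M.
HB.instance Definition _ := GRing.Zmodule.on endo.
HB.instance Definition _ := GRing.Zmodule_isPzRing.Build endo
  (fun h g f => @composeA T M M M M h g f)
  (@compose_idl T M M) (@compose_idr T M M)
  (fun g g' f => composeDl g g' f) (fun g f f' => composeDr g f f').

Definition annihilator (F : T) (f : Mor F M) : set endo :=
  [set g : endo | (g : Mor M M) ∘ f = 0].

Lemma annihilator_left_ideal F (f : Mor F M) : left_ideal (annihilator f).
Proof.
rewrite /annihilator; split=> [/=|]; first exact: compose0l.
split=> [g g' /= gf g'f|h g /= gf]; first by rewrite composeDl gf g'f addr0.
by rewrite -composeA gf compose0r.
Qed.

Definition compact_open (I : set endo) :=
  left_ideal I /\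
  exists (F : T) (f : Mor F M), compact_object F /\ annihilator f `<=` I.

Lemma compact_open_ideal I : compact_open I -> left_ideal I.
Proof. by case. Qed.

Lemma compact_open_ex : exists I, compact_open I.
Proof.
have [Z Z0] := zero_object T; exists (annihilator (0 : Mor Z M)).
split; first exact: annihilator_left_ideal.
by exists Z, 0; split=> //; apply: compact0.
Qed.

Lemma compact_openI I J : compact_open I -> compact_open J ->
  compact_open (I `&` J).
Proof.
move=> [[I0 [ID IM]] [F [f [cF fI]]]] [[J0 [JD JM]] [G [g [cG gJ]]]]; split.
  split; first by split.
  by split=> [x y [? ?] [? ?]|r x [? ?]]; split; auto.
have [B [i [j [p [q [pi [qj [pj [qi ijpq]]]]]]]]] := biproducts F G.
exists B, (f ∘ p + g ∘ q); split; first exact: compact_biproduct ijpq cF cG.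
move=> h /= hB; split; [apply: fI | apply: gJ]; rewrite /annihilator /=.
  have := congr1 (fun k => k ∘ i) hB.
  by rewrite compose0l -composeA composeDl -!composeA pi qi compose0r addr0 compose_idr.
have := congr1 (fun k => k ∘ j) hB.
by rewrite compose0l -composeA composeDl -!composeA pj qj compose0r add0r compose_idr.
Qed.

Lemma compact_openS I J : compact_open I -> left_ideal J -> I `<=` J ->
  compact_open J.
Proof.
move=> [_ [F [f [cF fI]]]] J0 IJ; split=> //.
by exists F, f; split=> // g /fI/IJ.
Qed.

Lemma compact_openM (r : endo) I : compact_open I ->
  exists J, compact_open J /\ forall s, J s -> I (s * r).
Proof.
move=> [_ [F [f [cF fI]]]]; exists (annihilator ((r : Mor M M) ∘ f)); split.
  split; first exact: annihilator_left_ideal.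
  by exists F, ((r : Mor M M) ∘ f); split.
move=> s; rewrite /annihilator /= composeA => sr; exact: fI.
Qed.

(* End(M) with the compact topology; the product of g and f is g ∘ f. *)
Definition compact_topology : topRing :=
  TopRing compact_open_ideal compact_open_ex compact_openI compact_openS
    compact_openM.

End CompactTopology.

Section HomContramodule.
Variables (T : additive_category) (cop : has_coproducts T) (P : T).

Definition copower (Z : small) : coproduct (fun _ : Z => P) :=
  cop (fun _ : Z => P).

Definition copower_proj (Z : small) (z : Z) : Mor (copower Z) P :=
  cp_case (copower Z) (fun z' => if `[< z' = z >] then idm P else 0).

Definition coordinates (Z : small) (phi : Mor P (copower Z)) (z : Z) :
  compact_topology P := copower_proj z ∘ phi.

Definition evaluation (X : T) : Mor (copower (Mor P X)) X :=
  cp_case (copower (Mor P X)) id.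

(* The morphism P -> P^(Z) with the given family of coordinates (0 if there is
   none), for Z = Mor(P, X), followed by the evaluation. *)
Definition hom_contraact
    (cs : complete_ring (compact_topology P) /\ separated_ring (compact_topology P))
    (X : T) (u : lincomb (CompleteTopRing cs) (Mor P X)) : Mor P X :=
  evaluation X ∘
    xget (0 : Mor P (copower (Mor P X))) [set phi | coordinates phi = u].

End HomContramodule.

Arguments coordinates {T} cop {P Z} phi z.
Arguments hom_contraact {T} cop {P} cs X u.

Section HomFunctor.
Variables (T : triangulated_category) (cop : has_coproducts T).
Variables (t : t_structure T) (P : heart t).
Variable cs : complete_ring (compact_topology (sval P)) /\
  separated_ring (compact_topology (sval P)).
Hypothesis laws : forall X : heart t,
  contramodule_laws (hom_contraact cop cs (sval X)).

Definition hom_contramodule (X : heart t) : contramodule (CompleteTopRing cs) :=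
  @Contramodule (CompleteTopRing cs) (Mor P X)
    (hom_contraact cop cs (sval X)) (laws X).

Definition hom_map (X Y : heart t) (f : Mor X Y) :
  hom_contramodule X -> hom_contramodule Y := fun g : Mor P X => f ∘ g.

Hypothesis morphisms : forall (X Y : heart t) (f : Mor X Y),
  contra_morphism (hom_map f).

Definition hom_functor : functor (heart t) (Ctra (CompleteTopRing cs)).
Proof.
refine (@Functor (heart t) (Ctra (CompleteTopRing cs)) hom_contramodule
  (fun X Y f => exist _ (hom_map f) (morphisms f)) _ _).
- by move=> X; apply: contra_hom_inj; apply/funext => g; apply: compose_idl.
- move=> X Y Z g f; apply: contra_hom_inj; apply/funext => h.
  by apply/esym; apply: composeA.
Defined.

End HomFunctor.

Arguments hom_map {T cop t P cs} laws {X Y} f.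
Arguments hom_functor {T cop t P cs laws} morphisms.

(* Main.v *)
Require Import Defs.
From HB Require Import structures.
From mathcomp Require Import all_boot all_algebra.
From mathcomp Require Import boolp classical_sets functions cardinality fsbigop.

Set Implicit Arguments.
Unset Strict Implicit.
Unset Printing Implicit Defensive.

Import GRing.Theory.
Local Open Scope quotient_scope.
Local Open Scope ring_scope.

(** Write S for the shift, and say that a map f between compact objects is null
if Hom(f, P) = 0; then Def(P) consists of the objects X with Hom(f, X) = 0 for
all null f. A map is phantom if it vanishes on all maps from compact objects,
and i is a pure monomorphism if composing with i is injective on maps from
compact objects.

Everything rests on one fact about N in Def(P): every transformation
Hom(F, P) -> Hom(F, N) that is natural in the compact object F is composition
with a unique morphism P -> N. If N -> E -> C is a triangle in which N -> E is a
pure monomorphism and E lies in Def(P), then C lies in Def(P) as well, hence in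
the heart, and Hom(S P, C) = 0 because of the t-structure; so composition with
N -> E is injective on maps from P. It remains to find such an E that kills a
given phantom map P -> N, or over which a given transformation is realised by a
morphism. The cone of the phantom map, respectively the cone of K -> N where K
is the fibre of a map from a sum of compacts to P through which all maps from
compacts to P factor, does this but lies outside Def(P). It is moved into
Def(P) by killing all null maps into it and iterating countably often
([pure_envelope]). The composite with N stays a pure monomorphism, since an
element of N that becomes null already vanishes in N
([factors_null_pure_mono]).

The fact is [no_phantom] with [lift_transformation]. For N = P it says that
End(P) is separated and complete. For N a copower of P, which again lies in
Def(P), it says that a map P -> P^(Z) is the same as a zero-convergent family of
coordinates. Under this identification the unit and the multiplication of the
monad become the injections and the composition of maps between copowers
([of_lincomb_unit], [of_lincomb_map], [of_lincomb_mul]), whence the contramodule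
axioms for Hom(P, X).

The copowers of the projective generator P thus lie in the heart, where they
correspond to the free contramodules. Hom(P, -) is faithful because P is a
generator; it is full because X is the cokernel of the kernel of
P^(Hom(P, X)) -> X; and a contramodule C is the image of the cokernel of
P^(N) -> P^(C), with N the set of the maps P -> P^(C) that C evaluates to zero.
Exactness of this presentation on maps from P uses Hom(P, S A) = 0 for A in the
heart ([projective_ext0]). The heart is abelian by the usual argument with the
truncation of a cone, and the contramodules inherit this along the
equivalence. *)

(** * Finite support of maps from a compact object to a coproduct *)

Lemma sum_widen (A : zmodType) (I : eqType) (r t : seq I) (f : I -> A) :
  uniq r -> uniq t -> {subset r <= t} -> (forall i, i \notin r -> f i = 0) ->
  \sum_(i <- r) f i = \sum_(i <- t) f i.
Proof.
move=> ur ut rt f0; rewrite [RHS](bigID (mem r)) /= [X in _ + X]big1 ?addr0 //.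
rewrite -[RHS]big_filter; apply/perm_big/uniq_perm => //; first exact: filter_uniq.
move=> i; rewrite mem_filter; apply/idP/andP => [ir|[]//].
by split=> //; apply: rt.
Qed.

Section AdditiveCategory.
Variable T : additive_category.
Implicit Types X Y Z F G : T.

Lemma composeBr X Y Z (g : Mor Y Z) (f f' : Mor X Y) :
  g ∘ (f - f') = g ∘ f - g ∘ f'.
Proof. by apply: (addIr (g ∘ f')); rewrite -composeDr !subrK. Qed.

Lemma composeNr X Y Z (g : Mor Y Z) (f : Mor X Y) : g ∘ (- f) = - (g ∘ f).
Proof. by rewrite -sub0r composeBr compose0r sub0r. Qed.

Lemma composeNl X Y Z (g : Mor Y Z) (f : Mor X Y) : (- g) ∘ f = - (g ∘ f).
Proof. by rewrite -sub0r composeBl compose0l sub0r. Qed.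

Lemma compose_suml X Y Z (J : Type) (s : seq J) (g : J -> Mor Y Z) (f : Mor X Y) :
  (\sum_(j <- s) g j) ∘ f = \sum_(j <- s) (g j ∘ f).
Proof.
elim: s => [|j s IH]; first by rewrite !big_nil compose0l.
by rewrite !big_cons composeDl IH.
Qed.

Lemma compose_sumr X Y Z (J : Type) (s : seq J) (g : Mor Y Z) (f : J -> Mor X Y) :
  g ∘ (\sum_(j <- s) f j) = \sum_(j <- s) (g ∘ f j).
Proof.
elim: s => [|j s IH]; first by rewrite !big_nil compose0r.
by rewrite !big_cons composeDr IH.
Qed.

Lemma hom_to0 X Y (f : Mor X Y) : idm Y = 0 -> f = 0.
Proof. by move=> Y0; rewrite -[f]compose_idl Y0 compose0l. Qed.

Lemma coproduct_ext (I : small) (X : I -> T) (C : coproduct X) Y (f g : Mor C Y) :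
  (forall i, f ∘ cp_inj C i = g ∘ cp_inj C i) -> f = g.
Proof.
by move=> fg; rewrite (cp_case_uniq fg); apply/esym/cp_case_uniq.
Qed.

Section CoproductProjections.
Variables (I : small) (X : I -> T) (C : coproduct X).

(** Defined on a family that varies with the index, hence the transport along
j = i. *)
Definition cp_delta (i j : I) : Mor (X j) (X i) :=
  match pselect (j = i) with
  | left e => ecast k (Mor (X j) (X k)) e (idm (X j))
  | right _ => 0
  end.

Definition cp_proj (i : I) : Mor C (X i) := cp_case C (cp_delta i).

Lemma cp_proj_inj i : cp_proj i ∘ cp_inj C i = idm (X i).
Proof.
rewrite cp_caseK /cp_delta; case: pselect => // e.
by rewrite (Prop_irrelevance e erefl).
Qed.

Lemma cp_proj_inj0 i j : j <> i -> cp_proj i ∘ cp_inj C j = 0.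
Proof. by move=> ji; rewrite cp_caseK /cp_delta; case: pselect. Qed.

Lemma cp_proj_uniq i (p : Mor C (X i)) : p ∘ cp_inj C i = idm (X i) ->
  (forall j, j <> i -> p ∘ cp_inj C j = 0) -> p = cp_proj i.
Proof.
move=> pi pj; apply: coproduct_ext => j.
have [->|ji] := pselect (j = i); first by rewrite pi cp_proj_inj.
by rewrite pj // cp_proj_inj0.
Qed.

Definition supported_on F (y : Mor F C) (s : seq {classic I}) :=
  y = \sum_(i <- s) (cp_inj C i ∘ (cp_proj i ∘ y)).

(** A finite sum of maps through injections, possibly with repeated indices, is
the sum of its own components. This lets a finite expression be produced in any
form. *)
Lemma supported_span F (l : seq {i : I & Mor F (X i)}) (y : Mor F C) :
  y = \sum_(u <- l) (cp_inj C (tag u) ∘ tagged u) ->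
  exists s, uniq s /\ supported_on y s.
Proof.
move=> yE; pose s := undup [seq (tag u : {classic I}) | u <- l].
have us : uniq s by apply: undup_uniq.
exists s; split=> //; rewrite /supported_on {2}yE.
under eq_bigr => i _ do rewrite !compose_sumr.
rewrite exchange_big /= yE.
apply: (@eq_big_seq _ _ _ {classic {i : I & Mor F (X i)}}) => u ul.
have us' : (tag u : {classic I}) \in s by rewrite mem_undup map_f.
rewrite (bigD1_seq (tag u : {classic I})) //= big1_seq => [|i /andP[iu _]].
  by rewrite addr0 [cp_proj _ ∘ _]composeA cp_proj_inj compose_idl.
rewrite [cp_proj _ ∘ _]composeA cp_proj_inj0 ?compose0l ?compose0r //.
by move=> e; move: iu; rewrite e eqxx.
Qed.

Lemma supported_proj F (y : Mor F C) s i : supported_on y s ->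
  i \notin s -> cp_proj i ∘ y = 0.
Proof.
move=> -> si; rewrite compose_sumr big1_seq // => j /andP[_ js].
rewrite composeA cp_proj_inj0 ?compose0l // => ji.
by move: si; rewrite -ji js.
Qed.

Lemma supported_sub F (y : Mor F C) s t : uniq t -> {subset s <= t} ->
  uniq s -> supported_on y s -> supported_on y t.
Proof.
move=> ut st us ys; rewrite /supported_on {1}ys; apply: sum_widen => // i.
by move=> /(supported_proj ys) ->; rewrite compose0r.
Qed.

Lemma supported_inj F (y y' : Mor F C) s s' :
  supported_on y s -> supported_on y' s' ->
  (forall i, cp_proj i ∘ y = cp_proj i ∘ y') -> y = y'.
Proof.
move=> ys ys' yy'; apply/eqP; rewrite -subr_eq0; apply/eqP.
have [|t [_ ->]] := @supported_span F
  (map (fun i => Tagged (fun i => Mor F (X i)) (cp_proj i ∘ y)) s ++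
   map (fun i => Tagged (fun i => Mor F (X i)) (- (cp_proj i ∘ y'))) s') (y - y').
  rewrite big_cat !big_map /=; congr (_ + _); first exact: ys.
  by rewrite [in LHS]ys' -sumrN; apply: eq_bigr => i _; rewrite composeNr.
by rewrite big1 // => i _; rewrite composeBr yy' subrr compose0r.
Qed.

End CoproductProjections.

(** The element-wise form of compactness. The universal property that defines
compact objects is awkward to apply; this form is what every later argument
uses. *)
Definition finitary F := forall (I : small) (X : I -> T) (C : coproduct X)
  (y : Mor F C), exists s, uniq s /\ supported_on y s.

Section Span.
Variables (I : small) (X : I -> T) (C : coproduct X) (F : T).

Definition spanned (y : Mor F C) := exists l : seq {i : I & Mor F (X i)},
  y = \sum_(u <- l) (cp_inj C (tag u) ∘ tagged u).

Definition span : {pred Mor F C} := [pred y | `[< spanned y >]].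

Lemma span_zmod_closed : zmod_closed span.
Proof.
split; first by apply/asboolP; exists [::]; rewrite big_nil.
move=> y y' /asboolP[l ->] /asboolP[l' ->]; apply/asboolP.
exists (l ++ map (fun u : {i : I & Mor F (X i)} =>
  Tagged (fun i => Mor F (X i)) (- (tagged u : Mor F (X (tag u))))) l').
rewrite big_cat big_map /= -sumrN; congr (_ + _).
by apply: eq_bigr => u _; rewrite composeNr.
Qed.
HB.instance Definition _ :=
  GRing.isZmodClosed.Build (Mor F C) span span_zmod_closed.

End Span.

(** The universal property makes two additive maps equal as soon as they agree on
the maps through the injections. Applied to zero and to the quotient of
Hom(F, C) by the subgroup that these maps span, it shows the quotient to be
zero. *)
Lemma compact_spanned F : compact_object F ->
  forall (I : small) (X : I -> T) (C : coproduct X) (y : Mor F C), spanned y.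
Proof.
move=> cF I X C y; pose Q := Quotient.quot (@span I X C F).
have [b [_ b_uniq]] := cF I X C Q (fun i => \0).
have pi0 (y' : Mor F C) : \pi_Q y' = 0 -> spanned y'.
  move=> /eqP; rewrite -[0](raddf0 (\pi_Q)) -Quotient.idealrBE subr0.
  by move=> /asboolP.
have b0 : b =1 \0.
  by move=> g; apply/esym/(b_uniq \0).
apply: pi0; rewrite (b_uniq (\pi_Q : {additive _ -> Q})) ?b0 // => i g.
rewrite /= -[RHS](raddf0 (\pi_Q : {additive Mor F C -> Q})); apply/eqP.
rewrite -Quotient.idealrBE subr0.
apply/asboolP; exists [:: Tagged (fun i => Mor F (X i)) g].
by rewrite big_seq1.
Qed.

Lemma compact_finitary F : compact_object F -> finitary F.
Proof.
move=> cF I X C y; have [l yl] := compact_spanned cF y.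
exact: supported_span yl.
Qed.

(** The additive map induced by a family a sends g to the finite sum of the
a i (p_i g). The support of g is a chosen list, and additivity needs the sum to
be independent of that choice. *)
Lemma finitary_compact F : finitary F -> compact_object F.
Proof.
move=> fF I X C A a.
pose supp (g : Mor F C) : seq {classic I} := sval (cid (fF I X C g)).
have supp_uniq g : uniq (supp g) by rewrite /supp; case: cid => ? [].
have suppP g : supported_on g (supp g) by rewrite /supp; case: cid => ? [].
pose b g := \sum_(i <- supp g) a i (cp_proj C i ∘ g).
have bE g s : uniq s -> supported_on g s ->
    b g = \sum_(i <- s) a i (cp_proj C i ∘ g).
  move=> us gs; transitivity (\sum_(i <- undup (supp g ++ s)) a i (cp_proj C i ∘ g)).
    apply: sum_widen; rewrite ?undup_uniq // => i; last first.
      by move=> /(supported_proj (suppP g)) ->; rewrite raddf0.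
    by move=> ig; rewrite mem_undup mem_cat ig.
  apply/esym/sum_widen; rewrite ?undup_uniq // => i; last first.
    by move=> /(supported_proj gs) ->; rewrite raddf0.
  by move=> ig; rewrite mem_undup mem_cat ig orbT.
have bD g g' : b (g + g') = b g + b g'.
  pose t := undup (supp g ++ supp g').
  have sub1 : {subset supp g <= t} by move=> i ig; rewrite mem_undup mem_cat ig.
  have sub2 : {subset supp g' <= t}.
    by move=> i ig; rewrite mem_undup mem_cat ig orbT.
  have ut : uniq t by apply: undup_uniq.
  have gt := supported_sub ut sub1 (supp_uniq g) (suppP g).
  have g't := supported_sub ut sub2 (supp_uniq g') (suppP g').
  rewrite (bE _ _ ut gt) (bE _ _ ut g't) (bE _ t ut) -?big_split /=.
    by apply: eq_bigr => i _; rewrite composeDr raddfD.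
  rewrite /supported_on {1}gt {1}g't -big_split /=.
  by apply: eq_bigr => i _; rewrite -composeDr -composeDr.
have b_add : zmod_morphism b.
  by move=> g g'; apply: (addIr (b g')); rewrite -bD !subrK.
pose bM := GRing.isZmodMorphism.Build (Mor F C) A b b_add.
pose b0 : {additive Mor F C -> A} := HB.pack b bM.
have b0E i (g : Mor F (X i)) : b (cp_inj C i ∘ g) = a i g.
  have pg : cp_proj C i ∘ (cp_inj C i ∘ g) = g.
    by rewrite composeA cp_proj_inj compose_idl.
  have ig : supported_on (cp_inj C i ∘ g) [:: (i : {classic I})].
    by rewrite /supported_on big_seq1 pg.
  by rewrite (bE _ _ _ ig) // big_seq1 pg.
exists b0; split=> [//|b' b'E g].
rewrite [g in LHS](suppP g) raddf_sum.
by apply: eq_bigr => i _; rewrite b'E.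
Qed.
End AdditiveCategory.

(** * Isomorphisms and equivalences *)

Section Isomorphisms.
Variable C : category.
Implicit Types X Y Z : C.

Lemma iso_mono X Y (f : Mor X Y) : is_iso f -> monomorphism f.
Proof.
move=> [g [gf _]] Z a b /(congr1 (fun k => g ∘ k)).
by rewrite !composeA gf !compose_idl.
Qed.

Lemma iso_epi X Y (f : Mor X Y) : is_iso f -> epimorphism f.
Proof.
move=> [g [_ fg]] Z a b /(congr1 (fun k => k ∘ g)).
by rewrite -!composeA fg !compose_idr.
Qed.

Lemma iso_id X : is_iso (idm X).
Proof. by exists (idm X); rewrite !compose_idl. Qed.

Lemma iso_comp X Y Z (g : Mor Y Z) (f : Mor X Y) :
  is_iso g -> is_iso f -> is_iso (g ∘ f).
Proof.
move=> [g' [g'g gg']] [f' [f'f ff']]; exists (f' ∘ g'); split.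
  by rewrite -composeA [g' ∘ _]composeA g'g compose_idl.
by rewrite -composeA [f ∘ _]composeA ff' compose_idl.
Qed.

End Isomorphisms.

Lemma functor_iso (C D : category) (F : functor C D) (X Y : C) (f : Mor X Y) :
  is_iso f -> is_iso (fmap F f).
Proof. by move=> [g [gf fg]]; exists (fmap F g); rewrite -!fmap_comp gf fg !fmap_id. Qed.

Definition faithful (C D : category) (F : functor C D) :=
  forall (X Y : C) (f g : Mor X Y), fmap F f = fmap F g -> f = g.
Definition full (C D : category) (F : functor C D) :=
  forall (X Y : C) (h : Mor (F X) (F Y)), exists f, fmap F f = h.
Definition essentially_surjective (C D : category) (F : functor C D) :=
  forall Y : D, exists X : C, isomorphic (F X) Y.

Section Equivalence.
Variables (C D : category) (F : functor C D).
Hypothesis Feq : is_equivalence F.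

Lemma equivalence_faithful : faithful F.
Proof.
have [G [[t [t_iso tE]] _]] := Feq => X Y f g fg.
by apply: (iso_epi (t_iso X)); rewrite -!tE fg.
Qed.

Lemma equivalence_full : full F.
Proof.
have [G [[t [t_iso tE]] [t' [t'_iso t'E]]]] := Feq => X Y h.
have [s [st ts]] := t_iso X; exists (t Y ∘ fmap G h ∘ s).
have GF : fmap G (fmap F (t Y ∘ fmap G h ∘ s)) = fmap G h.
  by apply: (iso_mono (t_iso Y)); rewrite tE -!composeA st compose_idr.
by apply: (iso_epi (t'_iso (F X))); rewrite -!t'E GF.
Qed.

Lemma equivalence_essentially_surjective : essentially_surjective F.
Proof.
by have [G [_ [t' [t'_iso _]]]] := Feq => Y; exists (G Y), (t' Y).
Qed.

End Equivalence.

(** * Long exact sequences of a triangle *)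

Section Triangles.
Variable T : triangulated_category.
Notation S := (shift_functor T).
Implicit Types X Y Z W : T.

Lemma shift_inj X Y (f g : Mor X Y) : fmap S f = fmap S g -> f = g.
Proof. exact: equivalence_faithful (shift_equiv T) _ _ _ _. Qed.

Lemma shift_full X Y (h : Mor (S X) (S Y)) : exists f, fmap S f = h.
Proof. exact: equivalence_full (shift_equiv T) _ _ _. Qed.

Lemma shift_surj Y : exists X, isomorphic (S X) Y.
Proof. exact: equivalence_essentially_surjective (shift_equiv T) _. Qed.

Lemma shift0 X Y : fmap S (0 : Mor X Y) = 0.
Proof. by apply: (addrI (fmap S 0)); rewrite -shiftD !addr0. Qed.

Lemma shiftB X Y (f g : Mor X Y) : fmap S (f - g) = fmap S f - fmap S g.
Proof. by apply: (addIr (fmap S g)); rewrite -shiftD !subrK. Qed.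

Lemma shift_eq0 X Y (f : Mor X Y) : fmap S f = 0 -> f = 0.
Proof. by move=> Sf; apply: shift_inj; rewrite shift0. Qed.

Lemma shift_zero Z : idm Z = 0 -> idm (S Z) = 0.
Proof. by move=> Z0; rewrite -fmap_id Z0 shift0. Qed.

Section Exactness.
Variables (X Y Z : T) (f : Mor X Y) (g : Mor Y Z) (h : Mor Z (S X)).
Hypothesis fgh : triangle f g h.

Lemma triangle_comp0 : g ∘ f = 0.
Proof.
have [O O0] := zero_object T.
have [|c [<- _]] := triangle_mor (a := idm X) (b := f) (triangle_id X O0) fgh.
  by rewrite !compose_idr.
by rewrite compose0r.
Qed.

(** Exactness of Hom(W, -) and, for [triangle_extend], of Hom(-, W), at the middle
object, from a map between the given triangle and a trivial one. *)
Lemma triangle_lift W (y : Mor W Y) : g ∘ y = 0 -> exists x, y = f ∘ x.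
Proof.
move=> gy; have [O O0] := zero_object T.
have tri1 := (triangle_rot _ _ _).1 (triangle_id W O0).
have tri2 := (triangle_rot _ _ _).1 fgh.
have [|c [_ cE]] := triangle_mor (a := y) (b := (0 : Mor O Z)) tri1 tri2.
  by rewrite compose0l gy.
have [x xE] := shift_full c; exists x; apply: shift_inj.
move: cE; rewrite -xE fmap_id composeNl composeNr compose_idr => /oppr_inj.
by rewrite -fmap_comp.
Qed.

Lemma triangle_extend W (y : Mor Y W) : y ∘ f = 0 -> exists z, y = z ∘ g.
Proof.
move=> yf; have [O O0] := zero_object T.
have tri : triangle (0 : Mor O W) (idm W) (0 : Mor W (S O)).
  apply/triangle_rot; rewrite shift0 oppr0; apply: triangle_id.
  exact: shift_zero.
have [|c [cE _]] := triangle_mor (a := (0 : Mor X O)) (b := y) fgh tri.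
  by rewrite compose0r yf.
by exists c; rewrite cE compose_idl.
Qed.

End Exactness.

Lemma triangle_rotl X Y Z (f : Mor X Y) (g : Mor Y Z) (h : Mor Z (S X)) :
  triangle f g h -> triangle g h (- fmap S f).
Proof. by move=> /triangle_rot. Qed.

Section RotatedExactness.
Variables (X Y Z : T) (f : Mor X Y) (g : Mor Y Z) (h : Mor Z (S X)).
Hypothesis fgh : triangle f g h.

Lemma triangle_comp0_2 : h ∘ g = 0.
Proof. exact: triangle_comp0 (triangle_rotl fgh). Qed.
Lemma triangle_comp0_3 : fmap S f ∘ h = 0.
Proof.
have := triangle_comp0 (triangle_rotl (triangle_rotl fgh)).
by rewrite composeNl => /eqP; rewrite oppr_eq0 => /eqP.
Qed.
Lemma triangle_lift2 W (z : Mor W Z) : h ∘ z = 0 -> exists y, z = g ∘ y.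
Proof. exact: triangle_lift (triangle_rotl fgh) _ _. Qed.
Lemma triangle_lift3 W (w : Mor W (S X)) :
  fmap S f ∘ w = 0 -> exists z, w = h ∘ z.
Proof.
move=> fw; apply: (triangle_lift (triangle_rotl (triangle_rotl fgh))).
by rewrite composeNl fw oppr0.
Qed.
Lemma triangle_extend2 W (z : Mor Z W) : z ∘ g = 0 -> exists w, z = w ∘ h.
Proof. exact: triangle_extend (triangle_rotl fgh) _ _. Qed.
Lemma triangle_extend3 W (w : Mor (S X) W) :
  w ∘ h = 0 -> exists y, w = y ∘ fmap S f.
Proof.
move=> wh; have [y ->] := triangle_extend (triangle_rotl (triangle_rotl fgh)) wh.
by exists (- y); rewrite composeNl composeNr.
Qed.
End RotatedExactness.

Lemma triangle_shift X Y Z (f : Mor X Y) (g : Mor Y Z) (h : Mor Z (S X)) :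
  triangle f g h -> triangle (- fmap S f) (- fmap S g) (- fmap S h).
Proof. by move=> /triangle_rotl/triangle_rotl/triangle_rotl. Qed.

(** A cone is only determined by its first map; desuspending it puts f in the
second place. *)
Lemma triangle_cocone X Y (f : Mor X Y) :
  exists D (d : Mor D X) (w : Mor Y (S D)), triangle d f w.
Proof.
have [Z [g [h fgh]]] := triangle_cone f.
have [D [a a_iso]] := shift_surj Z; have [b [ba ab]] := a_iso.
have [d dE] := shift_full (h ∘ a); exists D, (- d), (b ∘ g).
apply/triangle_rot; rewrite -[- d]sub0r shiftB shift0 sub0r opprK dE.
apply: triangle_iso (iso_id X) (iso_id Y) _ _ _ _ fgh.
- by exists a; split; [exact: ab|exact: ba].
- by rewrite compose_idl compose_idr.
- by rewrite compose_idr.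
- by rewrite fmap_id compose_idl -composeA ab compose_idr.
Qed.

End Triangles.

(** * Compactness, purity and definability *)

Section Purity.
Variable T : triangulated_category.
Notation S := (shift_functor T).
Implicit Types X Y Z W N E F G H : T.

Section ShiftCoproduct.
Variables (I : small) (X : I -> T) (C : coproduct X).
Section Case.
Variables (Y : T) (f : forall i, Mor (S (X i)) Y).
Lemma shift_case_ex : exists g : Mor (S C) Y, forall i, g ∘ fmap S (cp_inj C i) = f i.
Proof.
have [Y' [a [b [ba ab]]]] := shift_surj Y.
exists (a ∘ fmap S (cp_case C (fun i => sval (cid (shift_full (b ∘ f i)))))) => i.
rewrite -composeA -fmap_comp cp_caseK; case: cid => k /= ->.
by rewrite composeA ab compose_idl.
Qed.
Lemma shift_case_uniq (g g' : Mor (S C) Y) :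
  (forall i, g ∘ fmap S (cp_inj C i) = g' ∘ fmap S (cp_inj C i)) -> g = g'.
Proof.
move=> gg'; have [Y' [a [b [ba ab]]]] := shift_surj Y.
have b_mono : monomorphism b by apply: iso_mono; exists a.
have [k kE] := shift_full (b ∘ g); have [k' k'E] := shift_full (b ∘ g').
apply: b_mono; rewrite -kE -k'E; congr (fmap S _); apply: coproduct_ext => i.
by apply: shift_inj; rewrite !fmap_comp kE k'E -!composeA gg'.
Qed.
Definition shift_case := sval (cid shift_case_ex).
End Case.
Lemma shift_caseK Y (f : forall i, Mor (S (X i)) Y) i :
  shift_case f ∘ fmap S (cp_inj C i) = f i.
Proof. by rewrite /shift_case; case: cid. Qed.

(** As S is an equivalence, S C is a coproduct of the S X_i; this moves statements
on finite support along the shift. *)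
Definition shift_coproduct : coproduct (fun i => S (X i)).
Proof.
apply: (@Coproduct T I _ (S C) (fun i => fmap S (cp_inj C i)) shift_case shift_caseK).
by move=> Y f g gf; apply: shift_case_uniq => i; rewrite gf shift_caseK.
Defined.

Lemma shift_cp_proj i : cp_proj shift_coproduct i = fmap S (cp_proj C i).
Proof.
apply/esym/cp_proj_uniq => [|j ji] /=; rewrite -fmap_comp.
  by rewrite cp_proj_inj fmap_id.
by rewrite cp_proj_inj0 // shift0.
Qed.
End ShiftCoproduct.

Lemma shift_sum X Y (J : Type) (s : seq J) (f : J -> Mor X Y) :
  fmap S (\sum_(j <- s) f j) = \sum_(j <- s) fmap S (f j).
Proof.
elim: s => [|j s IH]; first by rewrite !big_nil shift0.
by rewrite !big_cons shiftD IH.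
Qed.

(** For y : D -> C, the part y' of y over the finite support of S y w satisfies
S (y - y') w = 0, so that y - y' factors through F and has finite support
too. *)
Lemma cocone_finitary D F G (d : Mor D F) (f : Mor F G) (w : Mor G (S D)) :
  triangle d f w -> finitary F -> finitary G -> finitary D.
Proof.
move=> dfw fF fG I X C y.
have [s [us sP]] := fG I _ (shift_coproduct C) (fmap S y ∘ w).
pose y' := \sum_(i <- s) (cp_inj C i ∘ (cp_proj C i ∘ y)).
have [z zE] : exists z, y - y' = z ∘ d.
  have [|z zE] := triangle_extend3 (w := fmap S (y - y')) dfw.
    rewrite shiftB composeBl [fmap S y ∘ w]sP shift_sum compose_suml.
    apply/eqP; rewrite subr_eq0; apply/eqP; apply: eq_bigr => i _.
    by rewrite shift_cp_proj !fmap_comp !composeA.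
  have [k kE] := shift_full z; exists k; apply: shift_inj.
  by rewrite zE -kE fmap_comp.
have [t [ut tP]] := fF I X C z.
apply: (@supported_span T I X C D
  ([seq Tagged (fun i => Mor D (X i)) (cp_proj C i ∘ z ∘ d) | i <- t] ++
   [seq Tagged (fun i => Mor D (X i)) (cp_proj C i ∘ y) | i <- s])).
rewrite big_cat !big_map /= -[LHS](subrK y') zE; congr (_ + _).
rewrite [z in LHS]tP compose_suml; apply: eq_bigr => i _.
by rewrite -!composeA.
Qed.

Lemma cocone_compact D F G (d : Mor D F) (f : Mor F G) (w : Mor G (S D)) :
  triangle d f w -> compact_object F -> compact_object G -> compact_object D.
Proof.
move=> dfw /compact_finitary fF /compact_finitary fG.
exact: finitary_compact (cocone_finitary dfw fF fG).
Qed.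

Definition phantom_map X Y (g : Mor X Y) :=
  forall F (x : Mor F X), compact_object F -> g ∘ x = 0.
Definition pure_mono X Y (g : Mor X Y) :=
  forall F (x : Mor F X), compact_object F -> g ∘ x = 0 -> x = 0.

Variable P : T.
Definition hom_vanishes F G (f : Mor F G) X := forall h : Mor G X, h ∘ f = 0.

(** Def(P), with a condition for every null map instead of an intersection of
definable classes. *)
Definition definable_hull X := forall F G (f : Mor F G),
  compact_object F -> compact_object G -> hom_vanishes f P -> hom_vanishes f X.

Lemma definable_hull_Def X : definable_hull X -> Def P X.
Proof.
move=> DX D [I [F [G [f [cFG DE]]]]] /DE DP; apply/DE => i h.
by have [cF cG] := cFG i; apply: DX => // h'; apply: DP.
Qed.

Lemma definable_hull_self : definable_hull P.
Proof. by []. Qed.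

Lemma definable_hull_coproduct (I : small) (X : I -> T) (C : coproduct X) :
  (forall i, definable_hull (X i)) -> definable_hull C.
Proof.
move=> DX F G f cF cG fP h.
have [s [_ ->]] := compact_finitary cG h.
rewrite compose_suml big1 // => i _.
by rewrite -composeA (DX i _ _ _ cF cG fP (cp_proj C i ∘ h)) compose0r.
Qed.

(** For compact H these maps form a subgroup of Hom(H, E), namely the kernel of a
killing step on maps from H. *)
Definition factors_null H E (z : Mor H E) := exists G (f : Mor H G) (h : Mor G E),
  compact_object G /\ hom_vanishes f P /\ z = h ∘ f.

(** A sum of two such maps factors through the biproduct of the middle objects. *)
Lemma factors_null_sum H E (J : Type) (s : seq J) (z : J -> Mor H E) :
  (forall j, factors_null (z j)) -> factors_null (\sum_(j <- s) z j).
Proof.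
move=> zP; apply: big_ind => [|x y|j _]; last exact: zP.
  have [O O0] := zero_object T; exists O, 0, 0; split; first exact: compact0.
  by split=> [h|]; rewrite ?compose0r.
move=> [G [f [h [cG [fP ->]]]]] [G' [f' [h' [cG' [f'P ->]]]]].
have [B [i [j [p [q [pi [qj [pj [qi ijpq]]]]]]]]] := biproducts G G'.
exists B, (i ∘ f + j ∘ f'), (h ∘ p + h' ∘ q).
split; first exact: compact_biproduct ijpq cG cG'.
split=> [k|]; first by rewrite composeDr !composeA fP f'P addr0.
rewrite composeDl !composeDr -!composeA [p ∘ (i ∘ _)]composeA [p ∘ (j ∘ _)]composeA
  [q ∘ (i ∘ _)]composeA [q ∘ (j ∘ _)]composeA.
by rewrite pi qj pj qi !compose_idl !compose0l !compose0r addr0 add0r.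
Qed.

(** Let i x = h f with f null, and let d : D -> H be the fibre of f. Then
i x d = 0, so x d = 0 by purity on the compact object D. Hence x factors through
f, and vanishes because N lies in Def(P). *)
Lemma factors_null_pure_mono H N E (i : Mor N E) (x : Mor H N) : compact_object H ->
  definable_hull N -> pure_mono i -> factors_null (i ∘ x) -> x = 0.
Proof.
move=> cH DN iP [G [f [h [cG [fP xE]]]]].
have [D [d [w dfw]]] := triangle_cocone f.
have [|y ->] := triangle_extend (y := x) dfw; last exact: DN.
apply: iP; first exact: cocone_compact dfw cH cG.
by rewrite composeA xE -composeA (triangle_comp0 dfw) compose0r.
Qed.

End Purity.

Lemma seq_nat_bound (s : seq {classic nat}) :
  exists M, forall n : nat, (M <= n)%N -> (n : {classic nat}) \notin s.
Proof.
elim: s => [|a s [M IH]]; first by exists 0%N.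
exists (maxn M a.+1) => n; rewrite geq_max => /andP[Mn an].
rewrite in_cons negb_or (IH n Mn) andbT; apply/eqP => na.
by move: an; rewrite na ltnn.
Qed.

Lemma iso_compact (T : additive_category) (F G : T) :
  isomorphic F G -> compact_object F -> compact_object G.
Proof.
move=> [a [b [ba ab]]] cF; have [O O0] := zero_object T.
apply: (compact_biproduct (i := a) (p := b) (j := (0 : Mor O G)) (q := 0)).
- by rewrite compose0l addr0.
- exact: cF.
- exact: compact0.
Qed.

(** F is the fibre of the map 0 -> S F. *)
Lemma unshift_compact (T : triangulated_category) (F : T) :
  compact_object (shift_functor T F) -> compact_object F.
Proof.
move=> cSF; have [O O0] := zero_object T.
by apply: cocone_compact (triangle_rotl (triangle_id F O0)) _ cSF; apply: compact0.
Qed.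

(** * Pure envelopes in Def(P) *)

Section Envelope.
Variable T : triangulated_category.
Notation S := (shift_functor T).
Variable cop : has_coproducts T.
Variables (I : small) (K : I -> T).
Hypothesis K_skeleton : forall F, compact_object F -> exists i, isomorphic F (K i).
Variable P : T.
Implicit Types X Y Z W N E F G H : T.

(** The index type of one killing step. Restricting the ends of the null maps to
the skeleton K keeps it small enough for the coproduct to exist. *)
Record null_map E := NullMap {
  nm_dom : I;
  nm_cod : I;
  nm_map : Mor (K nm_dom) (K nm_cod);
  nm_compact : compact_object (K nm_cod);
  nm_null : hom_vanishes nm_map P;
  nm_target : Mor (K nm_cod) E }.

(** E' is the cone of the sum of all composites K_i -> K_j -> E with null first
map. A map H -> N that dies in E' comes, as a map to E, from that sum, so it
factors through a null map and was zero. *)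
Lemma kill_null_maps E : exists E' (e : Mor E E'),
  (forall F G (f : Mor F G) (h : Mor G E), compact_object F -> compact_object G ->
     hom_vanishes f P -> e ∘ h ∘ f = 0) /\
  (forall N (i : Mor N E), definable_hull P N -> pure_mono i -> pure_mono (e ∘ i)).
Proof.
pose J : small := null_map E.
pose cJ := cop (fun u : J => K (nm_dom u)).
pose phi : Mor cJ E := cp_case cJ (fun u : J => nm_target u ∘ nm_map u).
have [E' [e [h phi_e]]] := triangle_cone phi.
exists E', e; split.
  move=> F G f k cF cG fP.
  have [i [a [a' [a'a aa']]]] := K_skeleton cF.
  have [j [b [b' [b'b bb']]]] := K_skeleton cG.
  have cKj : compact_object (K j) by apply: iso_compact cG; exists b, b'.
  have nP : hom_vanishes (b ∘ f ∘ a') P.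
    by move=> m; rewrite !composeA fP compose0l.
  pose u : J := NullMap cKj nP (k ∘ b').
  have := triangle_comp0 phi_e => /(congr1 (fun m => m ∘ cp_inj cJ u ∘ a)).
  rewrite !compose0l -!composeA [phi ∘ _]composeA cp_caseK /=.
  by rewrite -!composeA a'a compose_idr [b' ∘ _]composeA b'b compose_idl.
move=> N i DN iP H x cH; rewrite -composeA => eix.
have [y yE] := triangle_lift phi_e eix.
apply: (factors_null_pure_mono cH DN iP); rewrite yE.
have [s [_ ->]] := compact_finitary cH y.
rewrite compose_sumr; apply: factors_null_sum => u.
exists (K (nm_cod u)), (nm_map u ∘ (cp_proj cJ u ∘ y)), (nm_target u).
split; first exact: nm_compact.
split=> [m|]; last by rewrite [LHS]composeA cp_caseK !composeA.
by rewrite composeA (@nm_null E u m) compose0l.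
Qed.

(** The homotopy colimit L of a sequence e, as the cone of d = 1 - shift. In
coordinates y_n, a map y from a compact object satisfies d y = z iff y_0 = z_0 and
y_(n+1) = z_(n+1) + e_n y_n. *)
Section Telescope.
Variables (E : nat -> T) (e : forall n, Mor (E n) (E n.+1)).
Let cE : coproduct E := cop E.
Let d : Mor cE cE := cp_case cE (fun n => cp_inj cE n - cp_inj cE n.+1 ∘ e n).

Lemma telescope_proj0 : cp_proj cE 0%N ∘ d = cp_proj cE 0%N.
Proof.
apply: coproduct_ext => n; rewrite -composeA cp_caseK composeBr composeA.
by rewrite [X in X ∘ e n]cp_proj_inj0 // compose0l subr0.
Qed.

Lemma telescope_projS n :
  cp_proj cE n.+1 ∘ d = cp_proj cE n.+1 - e n ∘ cp_proj cE n.
Proof.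
apply: coproduct_ext => m; rewrite -composeA cp_caseK composeBr composeBl composeA.
rewrite -[X in _ = _ - X]composeA; congr (_ - _).
have [->|mn] := pselect (m = n); first by rewrite !cp_proj_inj compose_idl compose_idr.
rewrite cp_proj_inj0 => [|[]//].
by rewrite compose0l cp_proj_inj0 // compose0r.
Qed.

(** The recursion for d y = 0 makes all coordinates vanish. It applies to the
shifted telescope because S cE is again a coproduct. *)
Lemma telescope_inj X (y : Mor X (S cE)) : compact_object X ->
  fmap S d ∘ y = 0 -> y = 0.
Proof.
move=> cX dy.
have [s [_ ys]] := compact_finitary (C := shift_coproduct cE) cX y.
suff p0 n : fmap S (cp_proj cE n) ∘ y = 0.
  by rewrite ys big1 // => n _; rewrite shift_cp_proj p0 compose0r.
elim: n => [|n IH].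
  by rewrite -telescope_proj0 fmap_comp -composeA dy compose0r.
have := congr1 (fun m => fmap S m ∘ y) (telescope_projS n).
rewrite shiftB fmap_comp composeBl -composeA dy compose0r fmap_comp -composeA IH.
by rewrite compose0r subr0.
Qed.

Variables (L : T) (pi : Mor cE L) (w : Mor L (S cE)).
Hypothesis tel : triangle d pi w.

Lemma telescope_glue n : pi ∘ cp_inj cE n = pi ∘ cp_inj cE n.+1 ∘ e n.
Proof.
have := congr1 (fun m => m ∘ cp_inj cE n) (triangle_comp0 tel).
rewrite compose0l -composeA cp_caseK composeBr composeA => /eqP.
by rewrite subr_eq0 => /eqP.
Qed.

(** A map from a compact object to L is a finite sum of maps through the E n, and
each of these may be pushed one step further, where null maps die. *)
Lemma telescope_definable_hull :
  (forall n F G (f : Mor F G) (h : Mor G (E n)), compact_object F ->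
    compact_object G -> hom_vanishes f P -> e n ∘ h ∘ f = 0) -> definable_hull P L.
Proof.
move=> killE F G f cF cG fP h.
have wh : w ∘ h = 0.
  by apply: telescope_inj => //; rewrite composeA (triangle_comp0_3 tel) compose0l.
have [y ->] := triangle_lift2 tel wh.
have [s [_ ->]] := compact_finitary cG y.
rewrite compose_sumr compose_suml big1 // => n _.
rewrite !composeA telescope_glue -!composeA.
have := killE n F G f (cp_proj cE n ∘ y) cF cG fP.
by rewrite -!composeA => ->; rewrite !compose0r.
Qed.

(** If i x dies in L then it is d y for some y, and the coordinates of y are the
images of x in the E n. As y has finite support, one of these is zero. *)
Lemma telescope_pure N (i : Mor N (E 0%N)) :
  (forall n (k : Mor N (E n)), pure_mono k -> pure_mono (e n ∘ k)) ->
  pure_mono i -> pure_mono (pi ∘ cp_inj cE 0%N ∘ i).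
Proof.
move=> eP iP H x cH; rewrite -!composeA => /(triangle_lift tel)[y yE].
have [s [_ ys]] := compact_finitary cH y.
pose fix k n : Mor N (E n) := if n is m.+1 then e m ∘ k m else i.
have kP n : pure_mono (k n) by elim: n => //= n; apply: eP.
have ky n : cp_proj cE n ∘ y = k n ∘ x.
  elim: n => [|n IH].
    by rewrite -telescope_proj0 -composeA -yE composeA cp_proj_inj compose_idl.
  have := congr1 (fun m => m ∘ y) (telescope_projS n).
  rewrite -composeA -yE composeA cp_proj_inj0 // compose0l composeBl => /esym/eqP.
  by rewrite subr_eq0 => /eqP ->; rewrite -composeA IH composeA.
have [M sM] := seq_nat_bound s.
by apply: (kP M) => //; rewrite -ky (supported_proj ys) // sM.
Qed.

End Telescope.

Definition kill_obj E := sval (cid (kill_null_maps E)).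
Definition kill_map E : Mor E (kill_obj E) := sval (cid (svalP (cid (kill_null_maps E)))).
Lemma kill_mapP E :
  (forall F G (f : Mor F G) (h : Mor G E), compact_object F -> compact_object G ->
     hom_vanishes f P -> kill_map E ∘ h ∘ f = 0) /\
  (forall N (i : Mor N E), definable_hull P N -> pure_mono i -> pure_mono (kill_map E ∘ i)).
Proof. exact: svalP (cid (svalP (cid (kill_null_maps E)))). Qed.

(** The telescope of the iterated killing steps lies in Def(P) because any null
map into it is killed one step later. *)
Lemma pure_envelope N E0 (i : Mor N E0) : definable_hull P N -> pure_mono i ->
  exists E (j : Mor E0 E), definable_hull P E /\ pure_mono (j ∘ i).
Proof.
move=> DN iP; pose E n := iter n kill_obj E0.
pose e n : Mor (E n) (E n.+1) := kill_map (E n).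
have [L [pi [w tel]]] :=
  triangle_cone (cp_case (cop E) (fun n => cp_inj (cop E) n - cp_inj (cop E) n.+1 ∘ e n)).
exists L, (pi ∘ cp_inj (cop E) 0%N); split.
  apply: (telescope_definable_hull tel) => n F G f h cF cG fP.
  by have [+ _] := kill_mapP (E n); apply.
apply: (telescope_pure tel) iP => n k kP.
by have [_ +] := kill_mapP (E n); apply.
Qed.

(** * Morphisms to Def(P) are transformations on compact objects *)

Variable t : t_structure T.
Hypothesis DefP : forall X, definable_hull P X -> in_heart t X.

Lemma aisle_to_shift_heart X Y (f : Mor (S X) Y) :
  aisle t X -> in_heart t Y -> f = 0.
Proof.
move=> aX [_ [V [cV [a [b [ba ab]]]]]].
have [k kE] := shift_full (a ∘ f).
have : k = 0 by apply: (coaisleP t V).1.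
move=> k0; move: kE; rewrite k0 shift0 => /(congr1 (fun m => b ∘ m)).
by rewrite composeA ba compose_idl compose0r.
Qed.

(** S g factors through S X -> C, which is zero as X lies in the aisle and C in
the heart. *)
Lemma cone_heart_reflects0 N E C (i : Mor N E) (p : Mor E C) w X (g : Mor X N) :
  triangle i p w -> definable_hull P C -> aisle t X -> i ∘ g = 0 -> g = 0.
Proof.
move=> ipw DC aX ig; apply: shift_eq0.
have [|z ->] := triangle_lift3 (w := fmap S g) ipw.
  by rewrite -fmap_comp ig shift0.
by rewrite [z](aisle_to_shift_heart _ aX (DefP DC)) compose0r.
Qed.

(** Purity makes every map from a compact object to C lift to E: its image in S N
is zero, which is seen on a desuspension of the compact object. *)
Lemma pure_cone_definable_hull N E C (i : Mor N E) (p : Mor E C) w :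
  triangle i p w -> pure_mono i -> definable_hull P E -> definable_hull P C.
Proof.
move=> ipw iP DE F G f cF cG fP h.
have [G' [a [b [ba ab]]]] := shift_surj G.
have [z zE] := shift_full (w ∘ h ∘ a).
have cG' : compact_object G'.
  by apply: unshift_compact; apply: iso_compact cG; exists b, a.
have z0 : z = 0.
  apply: iP => //; apply: shift_eq0.
  by rewrite fmap_comp zE !composeA (triangle_comp0_3 ipw) !compose0l.
have [|y ->] := triangle_lift2 (z := h) ipw.
  have := zE; rewrite z0 shift0 => /(congr1 (fun m => m ∘ b)).
  by rewrite compose0l -composeA ab compose_idr.
by rewrite -composeA (DE _ _ _ cF cG fP y) compose0r.
Qed.

Lemma phantom_cone_pure X N C (g : Mor X N) (i : Mor N C) w :
  triangle g i w -> phantom_map g -> pure_mono i.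
Proof.
move=> giw gP H x cH ix; have [y ->] := triangle_lift giw ix; exact: gP.
Qed.

(** The cone of g is a pure extension of N in which g dies. *)
Theorem no_phantom X N (g : Mor X N) :
  aisle t X -> definable_hull P N -> phantom_map g -> g = 0.
Proof.
move=> aX DN gP; have [E0 [i [w giw]]] := triangle_cone g.
have iP := phantom_cone_pure giw gP.
have [E [j [DE jiP]]] := pure_envelope DN iP.
have [C [p [v jipv]]] := triangle_cone (j ∘ i).
apply: (cone_heart_reflects0 jipv) aX _; first exact: pure_cone_definable_hull jipv jiP DE.
by rewrite -composeA (triangle_comp0 giw) compose0r.
Qed.

Section LiftTransformation.
Variables (X N : T) (aX : aisle t X) (DN : definable_hull P N).
Variable theta : forall F, Mor F X -> Mor F N.
Hypothesis theta_nat : forall F G (x : Mor G X) (a : Mor F G),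
  compact_object F -> compact_object G -> theta (x ∘ a) = theta x ∘ a.

(** Naturality implies additivity: use it on the zero endomorphism of F, and in
[naturalD] on the two injections of F into its double and on their sum. *)
Lemma natural0 F : compact_object F -> theta (0 : Mor F X) = 0.
Proof.
move=> cF; rewrite -[X in theta X](compose0r F (0 : Mor F X)) theta_nat //.
exact: compose0r.
Qed.

Lemma naturalD F (x y : Mor F X) : compact_object F ->
  theta (x + y) = theta x + theta y.
Proof.
move=> cF; have [B [i [j [p [q [pi [qj [pj [qi ijpq]]]]]]]]] := biproducts F F.
have cB := compact_biproduct ijpq cF cF.
pose m := x ∘ p + y ∘ q.
have mi : m ∘ i = x.
  by rewrite composeDl -!composeA pi qi compose0r addr0 compose_idr.
have mj : m ∘ j = y.
  by rewrite composeDl -!composeA pj qj compose0r add0r compose_idr.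
by rewrite -mi -mj -composeDr !theta_nat // -composeDr.
Qed.

(** The transformation gives a map v from the sum of all compact objects over X.
On the fibre k of that sum, v k is phantom, so v descends to X after passing to
an envelope E of the cone of v k. The composite X -> E -> C is phantom, hence
zero, and the map X -> E lifts to N. *)
Theorem lift_transformation : exists g : Mor X N,
  forall F (x : Mor F X), compact_object F -> g ∘ x = theta x.
Proof.
pose J : small := {i : I & {x : Mor (K i) X | compact_object (K i)}}.
pose cJ := cop (fun u : J => K (tag u)).
pose u : Mor cJ X := cp_case cJ (fun u : J => sval (tagged u)).
pose v : Mor cJ N := cp_case cJ (fun u : J => theta (sval (tagged u))).
have [D [k [w kuw]]] := triangle_cocone u.
have vkP : phantom_map (v ∘ k).
  move=> H x cH; have [s [_ sE]] := compact_finitary cH (k ∘ x).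
  have thetas : forall t : seq {classic J},
    theta (\sum_(j <- t) (sval (tagged (j : J)) ∘ (cp_proj cJ j ∘ (k ∘ x)))) =
    \sum_(j <- t) (v ∘ (cp_inj cJ j ∘ (cp_proj cJ j ∘ (k ∘ x)))).
    elim=> [|j r IH]; first by rewrite !big_nil natural0.
    rewrite !big_cons naturalD // IH [v ∘ _]composeA cp_caseK theta_nat //.
    exact: svalP (tagged (j : J)).
  rewrite -composeA sE compose_sumr -thetas.
  under eq_bigr => j _.
    rewrite -[sval _](cp_caseK cJ (fun u : J => sval (tagged u))) -composeA. over.
  by rewrite -compose_sumr -sE composeA (triangle_comp0 kuw) compose0l natural0.
have [E0 [i [w' vkiw]]] := triangle_cone (v ∘ k).
have iP := phantom_cone_pure vkiw vkP.
have [E [j [DE jiP]]] := pure_envelope DN iP.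
have [C [p [v' jipv]]] := triangle_cone (j ∘ i).
have DC := pure_cone_definable_hull jipv jiP DE.
have [|g gE] := triangle_extend (y := i ∘ v) kuw.
  by rewrite -composeA (triangle_comp0 vkiw).
have jg F (x : Mor F X) : compact_object F -> g ∘ x = i ∘ theta x.
  move=> cF; have [l [a [b [ba ab]]]] := K_skeleton cF.
  have cK : compact_object (K l) by apply: iso_compact cF; exists a, b.
  pose z : J := existT _ l (exist _ (x ∘ b) cK).
  have := congr1 (fun m => m ∘ cp_inj cJ z ∘ a) gE.
  rewrite -[g ∘ u ∘ _]composeA -[i ∘ v ∘ _]composeA !cp_caseK /=.
  rewrite theta_nat // -!composeA ba !compose_idr => <- //.
have [g' g'E] : exists g', j ∘ g = j ∘ i ∘ g'.
  apply: (triangle_lift jipv); apply: no_phantom => // F x cF.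
  by rewrite -!composeA jg // !composeA -(composeA p) (triangle_comp0 jipv) compose0l.
exists g' => F x cF; apply/eqP; rewrite -subr_eq0; apply/eqP.
apply: jiP => //; rewrite composeBr !composeA -g'E -!composeA jg // subrr //.
Qed.
End LiftTransformation.

End Envelope.
(** * The endomorphism ring and the coordinates of maps to a copower *)

Local Open Scope classical_set_scope.

Lemma residue_class_refl (R : topRing) (r : R) I : open_ideal I -> residue_class r I r.
Proof. by move=> Iop; rewrite /residue_class /= subrr; exact: (ideal0 Iop). Qed.

Lemma eq_csum (R : topRing) (X : Type) (r s : X -> R) : r =1 s -> csum r = csum s.
Proof. by move=> /funext ->. Qed.

Section Endomorphisms.
Variables (T : triangulated_category) (cop : has_coproducts T).
Variables (t : t_structure T) (P : T).
Hypothesis cg : compactly_generated T.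
Hypothesis aP : aisle t P.
Hypothesis DefP : forall X, Def P X -> in_heart t X.
Let R := compact_topology P.

Let DefP' X (DX : definable_hull P X) : in_heart t X := DefP (definable_hull_Def DX).

Lemma phantom_from_P N (g : Mor P N) : definable_hull P N -> phantom_map g -> g = 0.
Proof.
by have [[I [K Ksk]] _] := cg => DN; apply: (no_phantom cop Ksk DefP' aP).
Qed.

Lemma phantom_ext N (g g' : Mor P N) : definable_hull P N ->
  (forall F (x : Mor F P), compact_object F -> g ∘ x = g' ∘ x) -> g = g'.
Proof.
move=> DN gg'; apply/eqP; rewrite -subr_eq0; apply/eqP.
by apply: phantom_from_P => // F x cF; rewrite composeBl gg' // subrr.
Qed.

Lemma lift_from_P N (theta : forall F, Mor F P -> Mor F N) : definable_hull P N ->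
  (forall F G (x : Mor G P) (a : Mor F G),
    compact_object F -> compact_object G -> theta F (x ∘ a) = theta G x ∘ a) ->
  exists g : Mor P N, forall F (x : Mor F P), compact_object F -> g ∘ x = theta F x.
Proof.
by have [[I [K Ksk]] _] := cg => DN; apply: (lift_transformation cop Ksk DefP' aP).
Qed.

Let ann F (f : Mor F P) : set R := annihilator f.

Lemma annihilator_open F (f : Mor F P) : compact_object F ->
  open_ideal (ann f).
Proof.
move=> cF; change (compact_open (ann f)).
by split; [exact: annihilator_left_ideal | exists F, f; split].
Qed.

Lemma endo_separated : separated_ring R.
Proof.
move=> r s rs; apply: phantom_ext => [|F x cF]; first exact: definable_hull_self.
have := rs _ (annihilator_open x cF) => /seteqP[+ _] => /(_ r).
rewrite /residue_class /= subrr /ann /annihilator /= => /(_ (compose0l _ _)).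
by rewrite composeBl => /eqP; rewrite subr_eq0 => /eqP.
Qed.

(** The residue classes modulo the annihilators of the maps f from compact objects
form a natural transformation: f is sent to r f for any representative r of the
class modulo the annihilator of f. *)
Lemma endo_complete : complete_ring R.
Proof.
move=> c [c_class c_mono].
pose rep F (f : Mor F P) : R := xget 0 [set r | c (ann f) = residue_class r (ann f)].
have repP F (f : Mor F P) : compact_object F ->
    c (ann f) = residue_class (rep F f) (ann f).
  move=> cF; have [r rE] := c_class _ (annihilator_open f cF).
  by rewrite /rep; case: xgetP => [s _ //|/(_ r)].
have sub F G (x : Mor G P) (a : Mor F G) : ann x `<=` ann (x ∘ a).
  by move=> r; rewrite /ann /annihilator /= composeA => ->; apply: compose0l.
have [||g gE] := @lift_from_P P (fun F f => (rep F f : Mor P P) ∘ f).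
- exact: definable_hull_self.
- move=> F G x a cF cG.
  have := c_mono _ _ (annihilator_open (x ∘ a) cF) (annihilator_open x cG) (sub _ _ x a).
  rewrite !repP // => /(_ _ (residue_class_refl _ (annihilator_open x cG))).
  rewrite /residue_class /= /ann /annihilator /= composeA !composeBl => /eqP.
  by rewrite subr_eq0 => /eqP ->; rewrite composeA.
exists g => I Iop; have [_ [F [f [cF fI]]]] := Iop.
have fop := annihilator_open f cF.
have [r rE] := c_class _ Iop; rewrite rE.
apply: residue_class_eq => //; apply: (ideal_trans Iop (y := rep F f)).
  apply: fI; rewrite /ann /annihilator /= composeBl gE //; exact: subrr.
have := c_mono _ _ Iop fop fI; rewrite repP // rE; apply.
exact: residue_class_refl.
Qed.

Lemma copower_projE (Z : small) (z : Z) :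
  copower_proj cop P z = cp_proj (copower cop P Z) z.
Proof.
apply: cp_proj_uniq => [|z' z'z]; rewrite cp_caseK; first by rewrite asboolT.
by rewrite asboolF.
Qed.

Lemma copower_definable_hull (Z : small) : definable_hull P (copower cop P Z).
Proof. by apply: definable_hull_coproduct => _; apply: definable_hull_self. Qed.

Lemma coordinates_supported (Z : small) (phi : Mor P (copower cop P Z)) F (x : Mor F P) :
  compact_object F -> exists s : seq {classic Z},
    uniq s /\ (forall z, z \notin s -> (coordinates cop phi z : Mor P P) ∘ x = 0) /\
    phi ∘ x = \sum_(z <- s)
      (cp_inj (copower cop P Z) z ∘ ((coordinates cop phi z : Mor P P) ∘ x)).
Proof.
move=> cF; have [s [us sE]] := compact_finitary cF (phi ∘ x).
exists s; split=> //; split=> [z /(supported_proj sE)|].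
  by rewrite /coordinates copower_projE composeA.
rewrite {1}sE; apply: eq_bigr => z _.
by rewrite /coordinates copower_projE !composeA.
Qed.

Lemma coordinates_convergent (Z : small) (phi : Mor P (copower cop P Z)) :
  zero_convergent (coordinates cop phi).
Proof.
move=> I [_ [F [f [cF fI]]]].
have [s [_ [s0 _]]] := coordinates_supported phi f cF.
apply: (sub_finite_set _ (finite_seq s)) => z /= nI; apply: contrapT => /negP zs.
by apply: nI; apply: fI; apply: s0.
Qed.

Lemma coordinates_inj (Z : small) (phi psi : Mor P (copower cop P Z)) :
  coordinates cop phi = coordinates cop psi -> phi = psi.
Proof.
move=> e; apply: phantom_ext => [|F x cF]; first exact: copower_definable_hull.
have fF := compact_finitary cF.
have [s [_ sE]] := fF _ _ _ (phi ∘ x); have [s' [_ s'E]] := fF _ _ _ (psi ∘ x).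
apply: (supported_inj sE s'E) => z; rewrite !composeA -copower_projE.
by have := congr1 (fun c : Z -> R => (c z : Mor P P) ∘ x) e.
Qed.

(** On a map x from a compact object only finitely many r_z x are nonzero, so the
family defines a transformation to the copower. *)
Lemma coordinates_surj (Z : small) (r : Z -> R) : zero_convergent r ->
  exists phi, coordinates cop phi = r.
Proof.
move=> r0; pose cZ := copower cop P Z.
have ex_theta F (x : Mor F P) : exists y : Mor F cZ, compact_object F ->
    forall z, cp_proj cZ z ∘ y = (r z : Mor P P) ∘ x.
  have [cF|] := pselect (compact_object F); last by exists 0.
  have fS : finite_set ([set z | ~ ann x (r z)] : set {classic Z}).
    exact: (r0 _ (annihilator_open x cF)).
  have [s' s'E] := (finite_seqP _).1 fS; pose s := undup s'.
  exists (\sum_(z <- s) (cp_inj cZ z ∘ ((r z : Mor P P) ∘ x))) => _ z.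
  rewrite compose_sumr.
  have [zs|zs] := boolP ((z : {classic Z}) \in s).
    rewrite (bigD1_seq (z : {classic Z})) ?undup_uniq //=.
    rewrite big1_seq => [|i /andP[iz _]].
      by rewrite addr0 [LHS]composeA cp_proj_inj compose_idl.
    rewrite composeA cp_proj_inj0 ?compose0l // => e.
    by move: iz; rewrite e eqxx.
  have -> : (r z : Mor P P) ∘ x = 0.
    apply: contrapT => nz; move: zs; rewrite mem_undup => /negP; apply.
    by have : [set` s'] z by rewrite -s'E.
  rewrite big1_seq // => i /andP[_ iS].
  rewrite composeA cp_proj_inj0 ?compose0l // => e.
  by move: zs; rewrite -e iS.
pose theta F (x : Mor F P) := sval (cid (ex_theta F x)).
have thetaP F (x : Mor F P) : compact_object F ->
    forall z, cp_proj cZ z ∘ theta F x = (r z : Mor P P) ∘ x.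
  by rewrite /theta; case: cid.
have [||phi phiE] := @lift_from_P cZ theta.
- exact: copower_definable_hull.
- move=> F G x a cF cG; have fF := compact_finitary cF.
  have [s [_ sE]] := fF _ _ _ (theta F (x ∘ a)).
  have [s' [_ s'E]] := fF _ _ _ (theta G x ∘ a).
  apply: (supported_inj sE s'E) => z.
  by rewrite thetaP // [RHS]composeA thetaP // composeA.
exists phi; apply/funext => z; apply: phantom_ext => [|F x cF].
  exact: definable_hull_self.
by rewrite /coordinates -composeA phiE // copower_projE thetaP.
Qed.

Lemma coordinates_bij (Z : small) :
  set_bij setT [set r | zero_convergent r] (@coordinates T cop P Z).
Proof.
split=> [phi _|phi psi _ _|r /coordinates_surj[phi <-]].
- exact: coordinates_convergent.
- exact: coordinates_inj.
- by exists phi.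
Qed.

(** Composition with m is continuous: modulo the annihilator of any map from a
compact object, phi is a finite sum of its coordinates. *)
Lemma is_sum_composite (Z : small) (m : Mor (copower cop P Z) P)
    (phi : Mor P (copower cop P Z)) :
  @is_sum R Z (fun z => ((m ∘ cp_inj (copower cop P Z) z : R) * coordinates cop phi z)%R)
    (m ∘ phi).
Proof.
move=> I Iop; have [_ [F [f [cF fI]]]] := Iop.
have [s [us [s0 sE]]] := coordinates_supported phi f cF.
pose c : Z -> R := fun z => (m ∘ cp_inj (copower cop P Z) z : R) * coordinates cop phi z.
pose A : set {classic Z} := [set z | ~ I (c z)].
have As : A `<=` [set` s].
  move=> z /= nI; apply: contrapT => /negP zs; apply: nI; apply: fI.
  by rewrite /annihilator /= -composeA s0 // compose0r.
change (I ((m ∘ phi : R) - \sum_(z \in A) c z)).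
apply: (ideal_trans Iop (y := \sum_(z \in [set` s]) c z)); last first.
  rewrite -opprB; apply: idealN => //; apply: ideal_widen => //.
  by move=> z _ /contrapT.
apply: fI; rewrite /annihilator /=.
rewrite composeBl -composeA sE compose_sumr -fsbig_seq // compose_suml.
apply/eqP; rewrite subr_eq0; apply/eqP; apply: eq_bigr => z _.
by rewrite [LHS]composeA [LHS]composeA.
Qed.

(** * The contramodules Hom(P, X) *)

Section Contraaction.
Variable cs : complete_ring R /\ separated_ring R.
Let CR := CompleteTopRing cs.

Lemma is_sum_csum (Z : Type) (r : Z -> CR) (s : CR) :
  zero_convergent r -> is_sum r s -> csum r = s.
Proof.
move=> r0 rs; apply: ideal_separated => I Iop.
by apply: (ideal_trans Iop (csumP r0 Iop)); rewrite -opprB; apply: (idealN Iop); apply: rs.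
Qed.

Definition of_lincomb (Z : small) (u : lincomb CR Z) : Mor P (copower cop P Z) :=
  sval (cid (coordinates_surj (coef_convergent u))).

Lemma of_lincombK (Z : small) (u : lincomb CR Z) :
  coordinates cop (of_lincomb u) = u.
Proof. by rewrite /of_lincomb; case: cid. Qed.

Lemma of_lincomb_uniq (Z : small) (u : lincomb CR Z) phi :
  coordinates cop phi = u -> phi = of_lincomb u.
Proof. by move=> e; apply: coordinates_inj; rewrite e of_lincombK. Qed.

Definition to_lincomb (Z : small) (phi : Mor P (copower cop P Z)) : lincomb CR Z :=
  @Lincomb CR Z _ (coordinates_convergent phi).

Lemma to_lincombK (Z : small) (phi : Mor P (copower cop P Z)) :
  of_lincomb (to_lincomb phi) = phi.
Proof. exact/esym/of_lincomb_uniq. Qed.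

(** The default value in the definition of the contraaction is never reached,
since every zero-convergent family is a family of coordinates. *)
Lemma hom_contraactE X (u : lincomb CR (Mor P X)) :
  hom_contraact cop cs X u = evaluation cop P X ∘ of_lincomb u.
Proof.
rewrite /hom_contraact; congr (_ ∘ _); apply: of_lincomb_uniq.
by case: xgetP => [//|/(_ (of_lincomb u))]; rewrite /= of_lincombK.
Qed.

Lemma of_lincomb_unit (Z : small) (z : Z) :
  of_lincomb (lincomb_unit CR z) = cp_inj (copower cop P Z) z.
Proof.
apply/esym/of_lincomb_uniq/funext => z'.
rewrite /coordinates cp_caseK /= /single.
by congr (if _ then _ else _); apply/asboolP/asboolP.
Qed.

(** This turns every infinite sum in the definition of the monad into a
composite. *)
Lemma csum_composite (Z : small) (m : Mor (copower cop P Z) P) (u : lincomb CR Z) :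
  csum (fun z => (m ∘ cp_inj (copower cop P Z) z : CR) * u z) = m ∘ of_lincomb u.
Proof.
apply: is_sum_csum; last by rewrite -of_lincombK; apply: is_sum_composite.
move=> I Iop; apply: sub_finite_set (coef_convergent u Iop) => z /= nI uz.
exact: nI (idealMl Iop _ uz).
Qed.

Definition copower_map (Y Z : small) (f : Y -> Z) :
    Mor (copower cop P Y) (copower cop P Z) :=
  cp_case (copower cop P Y) (fun y => cp_inj (copower cop P Z) (f y)).

Lemma of_lincomb_map (Y Z : small) (f : Y -> Z) (u : lincomb CR Y) :
  of_lincomb (lincomb_map f u) = copower_map f ∘ of_lincomb u.
Proof.
apply/esym/of_lincomb_uniq/funext => z.
rewrite /coordinates composeA -csum_composite /= /push; apply: (@eq_csum CR Y) => y.
rewrite -composeA cp_caseK cp_caseK /restrict_coef /=.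
by case: asboolP => _; [exact: mul1r | exact: mul0r].
Qed.

(** Opening parentheses is composition with the map of copowers that has the inner
linear combinations as its columns. *)
Lemma of_lincomb_mul (Z : small) (w : lincomb CR (lincomb CR Z)) :
  of_lincomb (lincomb_mul w) =
  cp_case (copower cop P (lincomb CR Z)) (@of_lincomb Z) ∘ of_lincomb w.
Proof.
apply/esym/of_lincomb_uniq/funext => z.
rewrite /coordinates composeA -csum_composite /= /open_parentheses; apply: (@eq_csum CR) => u.
congr (_ * _); rewrite -composeA cp_caseK.
by have := of_lincombK u => /(congr1 (fun c : Z -> CR => c z)) => <-.
Qed.

Lemma hom_contraact_laws X : contramodule_laws (hom_contraact cop cs X).
Proof.
split=> [c|w]; first by rewrite hom_contraactE of_lincomb_unit cp_caseK.
rewrite !hom_contraactE of_lincomb_mul of_lincomb_map !composeA; congr (_ ∘ _).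
apply: coproduct_ext => u; rewrite -!composeA !cp_caseK.
by rewrite -hom_contraactE.
Qed.

Lemma hom_contraact_morphism X Y (f : Mor X Y) (u : lincomb CR (Mor P X)) :
  f ∘ hom_contraact cop cs X u =
  hom_contraact cop cs Y (lincomb_map (fun g => f ∘ g) u).
Proof.
rewrite !hom_contraactE of_lincomb_map !composeA; congr (_ ∘ _).
by apply: coproduct_ext => g; rewrite -!composeA !cp_caseK.
Qed.

End Contraaction.
End Endomorphisms.

(** * Kernels and cokernels in the heart *)

Section Heart.
Variables (T : triangulated_category) (t : t_structure T).
Notation S := (shift_functor T).
Implicit Types X Y Z U V W : T.

(** The aisle is not assumed to be closed under isomorphism, and so neither is the
heart. The orthogonals [aisle_closure] and [shifted_coaisle] are, and their
intersection is the isomorphism closure of the heart ([heart_repr]). *)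
Definition aisle_closure X := forall V (f : Mor X V), coaisle t V -> f = 0.
Definition shifted_coaisle X := forall U (f : Mor (S U) X), aisle_closure U -> f = 0.

Lemma aisle_sub_closure X : aisle t X -> aisle_closure X.
Proof. by move=> aX V f cV; apply: (coaisleP t V).1. Qed.

Lemma aisle_closure_iso X Y : isomorphic X Y -> aisle_closure X -> aisle_closure Y.
Proof.
move=> [a aI] lX V f cV; apply: (iso_epi aI).
by rewrite compose0l; apply: lX.
Qed.

Lemma shifted_coaisle_iso X Y : isomorphic X Y -> shifted_coaisle X -> shifted_coaisle Y.
Proof.
move=> [a [b [ba ab]]] rX U f lU; rewrite -[f]compose_idl -ab -composeA.
by rewrite (rX U (b ∘ f) lU) compose0r.
Qed.

Lemma isomorphic_sym (C : category) (X Y : C) : isomorphic X Y -> isomorphic Y X.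
Proof. by move=> [a [b [ba ab]]]; exists b, a. Qed.

(** In the truncation triangle U -> X -> V the second map is zero, so the identity
of V factors through S U and vanishes. *)
Lemma aisle_closure_aisle X : aisle_closure X -> exists U, aisle t U /\ isomorphic X U.
Proof.
move=> lX; have [U [V [f [g [h [aU [cV fgh]]]]]]] := t_triangle t X.
have g0 : g = 0 by apply: lX.
have V0 : idm V = 0.
  have [|s ->] := triangle_extend2 (z := idm V) fgh; first by rewrite compose_idl.
  by rewrite ((coaisleP t V).1 cV _ s (aisle_shift aU)) compose0l.
have [|r rE] := triangle_lift (y := idm X) fgh; first by rewrite compose_idr.
exists U; split=> //; exists r, f; split=> //.
apply/eqP; rewrite -subr_eq0; apply/eqP; apply: shift_eq0.
have [|z ->] := triangle_lift3 (w := fmap S (r ∘ f - idm U)) fgh.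
  by rewrite -fmap_comp composeBr composeA -rE compose_idl compose_idr subrr shift0.
by rewrite [z]hom_to0 // compose0r.
Qed.

Lemma aisle_closure_shift U : aisle_closure U -> aisle_closure (S U).
Proof.
move=> /aisle_closure_aisle[U' [aU' /isomorphic_sym[a aI]]].
apply: (@aisle_closure_iso (S U')); first by exists (fmap S a); apply: functor_iso.
exact: aisle_sub_closure (aisle_shift aU').
Qed.

Lemma shifted_coaisle_shift V : coaisle t V -> shifted_coaisle (S V).
Proof.
by move=> cV U f lU; have [k <-] := shift_full f; rewrite (lU V k cV) shift0.
Qed.

Lemma heart_aisle_closure X : in_heart t X -> aisle_closure X.
Proof. by move=> [/aisle_sub_closure]. Qed.

Lemma heart_shifted_coaisle X : in_heart t X -> shifted_coaisle X.
Proof.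
by move=> [_ [V [cV /isomorphic_sym XV]]]; apply: shifted_coaisle_iso XV (shifted_coaisle_shift cV).
Qed.

Lemma heart_repr X : aisle_closure X -> shifted_coaisle X ->
  exists Y : heart t, isomorphic X (sval Y).
Proof.
move=> lX rX; have [U [aU XU]] := aisle_closure_aisle lX.
have [V VU] := shift_surj U.
have cV : coaisle t V.
  apply/coaisleP => U' f aU'; apply: shift_eq0.
  have rSV : shifted_coaisle (S V).
    apply: shifted_coaisle_iso rX; case: XU (isomorphic_sym VU) => a aI [b bI].
    by exists (b ∘ a); apply: iso_comp.
  exact: rSV (aisle_sub_closure aU').
have hU : in_heart t U by split=> //; exists V; split=> //; apply: isomorphic_sym.
by exists (exist _ U hU).
Qed.

Lemma truncation X : exists U V (u : Mor (S U) X) (v : Mor X V) w,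
  triangle u v w /\ aisle_closure U /\ shifted_coaisle V.
Proof.
have [X' [a aI]] := shift_surj X; have [b [ba ab]] := aI.
have [U [V [f [g [h [aU [cV fgh]]]]]]] := t_triangle t X'.
exists U, (S V), (a ∘ - fmap S f), (- fmap S g ∘ b), (- fmap S h); split.
  apply: triangle_iso (iso_id _) aI (iso_id _) _ _ _ (triangle_shift fgh).
  - by rewrite compose_idr.
  - by rewrite compose_idl -composeA ba compose_idr.
  - by rewrite fmap_id compose_idl compose_idr.
by split; [exact: aisle_sub_closure | exact: shifted_coaisle_shift].
Qed.

Section HeartCone.
Variables (A B : heart t) (f : Mor (sval A) (sval B)).

Let lA := heart_aisle_closure (svalP A).
Let lB := heart_aisle_closure (svalP B).
Let rA := heart_shifted_coaisle (svalP A).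
Let rB := heart_shifted_coaisle (svalP B).

(** Truncating the cone of f yields the cokernel Q of f and the shift of its
kernel K: the objects U and V of the truncation lie in the heart because the cone
is an extension of S A by B. *)
Lemma heart_cone : exists (K Q : heart t) C (g : Mor (sval B) C)
    (h : Mor C (S (sval A))) (u : Mor (S (sval K)) C) (v : Mor C (sval Q)) w,
  triangle f g h /\ triangle u v w.
Proof.
have [C [g [h fgh]]] := triangle_cone f.
have [U [V [u [v [w [uvw [lU rV]]]]]]] := truncation C.
have lC : aisle_closure C.
  move=> W z cW; have [|y ->] := triangle_extend2 (z := z) fgh; first exact: lB.
  by rewrite [y](aisle_closure_shift lA) ?compose0l.
have lV : aisle_closure V.
  move=> W z cW; have [|y ->] := triangle_extend2 (z := z) uvw; first exact: lC.
  by rewrite [y](aisle_closure_shift (aisle_closure_shift lU)) ?compose0l.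
have rU : shifted_coaisle U.
  move=> W z lW; apply: shift_eq0; apply: shift_eq0.
  have uz : u ∘ fmap S z = 0.
    have [|y ->] := triangle_lift2 (z := u ∘ fmap S z) fgh; last first.
      by rewrite (rB y (aisle_closure_shift lW)) compose0r.
    have [y yE] := shift_full (h ∘ (u ∘ fmap S z)).
    by rewrite -yE (rA y) ?shift0.
  have [|y ->] := triangle_lift3 (w := fmap S (fmap S z)) uvw.
    by rewrite -fmap_comp uz shift0.
  by rewrite [y](rV _ _ (aisle_closure_shift (aisle_closure_shift lW))) compose0r.
have [K [a aI]] := heart_repr lU rU; have [a' [a'a aa']] := aI.
have [Q [b bI]] := heart_repr lV rV; have [b' [b'b bb']] := bI.
exists K, Q, C, g, h, (u ∘ fmap S a'), (b ∘ v), (fmap S (fmap S a) ∘ w ∘ b').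
split=> //; apply: triangle_iso (functor_iso S aI) (iso_id C) bI _ _ _ uvw.
- by rewrite compose_idl -composeA -fmap_comp a'a fmap_id compose_idr.
- by rewrite compose_idr.
- by rewrite -!composeA b'b compose_idr.
Qed.

(** Besides the universal properties: if the kernel is zero then f is the kernel
of q, as the cone is then Q itself; dually if the cokernel is zero. The last
clause is the exactness of Hom(W, -) at B, for W with no maps to shifts of heart
objects, which applies to the projective objects of the heart. *)
Lemma heart_ker_coker : exists (K Q : heart t)
    (k : Mor (sval K) (sval A)) (q : Mor (sval B) (sval Q)),
  [/\ f ∘ k = 0 /\ (forall (W : heart t) (a : Mor (sval W) (sval A)),
        f ∘ a = 0 -> exists! b, k ∘ b = a),
      q ∘ f = 0 /\ (forall (W : heart t) (a : Mor (sval B) (sval W)),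
        a ∘ f = 0 -> exists! b, b ∘ q = a),
      idm (sval K) = 0 -> forall W (a : Mor W (sval B)),
        q ∘ a = 0 -> exists b, f ∘ b = a,
      idm (sval Q) = 0 -> forall (W : heart t) (a : Mor (sval A) (sval W)),
        a ∘ k = 0 -> exists b, b ∘ f = a &
      forall W (a : Mor W (sval B)),
        (forall (X : heart t) (z : Mor W (S (sval X))), z = 0) ->
        q ∘ a = 0 -> exists b, f ∘ b = a].
Proof.
have [K [Q [C [g [h [u [v [w [fgh uvw]]]]]]]]] := heart_cone.
have lK := heart_aisle_closure (svalP K); have rQ := heart_shifted_coaisle (svalP Q).
have [k kE] := shift_full (h ∘ u); exists K, Q, k, (v ∘ g).
split.
- split.
    by apply: shift_eq0; rewrite fmap_comp kE composeA (triangle_comp0_3 fgh) compose0l.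
  have k_mono (W : heart t) (b : Mor (sval W) (sval K)) : k ∘ b = 0 -> b = 0.
    have lW := heart_aisle_closure (svalP W).
    move=> kb; apply: shift_eq0; apply: shift_eq0.
    have ub : u ∘ fmap S b = 0.
      have [|y ->] := triangle_lift2 (z := u ∘ fmap S b) fgh.
        by rewrite composeA -kE -fmap_comp kb shift0.
      by rewrite (rB y lW) compose0r.
    have [|y ->] := triangle_lift3 (w := fmap S (fmap S b)) uvw.
      by rewrite -fmap_comp ub shift0.
    by rewrite [y](rQ _ _ (aisle_closure_shift lW)) compose0r.
  move=> W a fa; have lW := heart_aisle_closure (svalP W).
  have [|z zE] := triangle_lift3 (w := fmap S a) fgh; first by rewrite -fmap_comp fa shift0.
  have [|b' b'E] := triangle_lift (y := z) uvw; first exact: rQ.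
  have [b bE] := shift_full b'; exists b.
  have kb : k ∘ b = a by apply: shift_inj; rewrite fmap_comp kE -composeA bE -b'E zE.
  split=> // c kc; apply/eqP; rewrite -subr_eq0; apply/eqP/k_mono.
  by rewrite composeBr kb kc subrr.
- split; first by rewrite -composeA (triangle_comp0 fgh) compose0r.
  have q_epi (W : heart t) (b : Mor (sval Q) (sval W)) : b ∘ (v ∘ g) = 0 -> b = 0.
    have rW := heart_shifted_coaisle (svalP W).
    rewrite composeA => bvg.
    have [y bv] := triangle_extend2 fgh bvg.
    have [|z ->] := triangle_extend2 (z := b) uvw.
      by rewrite bv [y](rW _ _ lA) compose0l.
    by rewrite [z](rW _ _ (aisle_closure_shift lK)) compose0l.
  move=> W a af; have rW := heart_shifted_coaisle (svalP W).
  have [a' a'E] := triangle_extend fgh af.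
  have [|b bE] := triangle_extend (y := a') uvw; first exact: rW.
  have bq : b ∘ (v ∘ g) = a by rewrite composeA -bE.
  exists b; split=> // c cq; apply/eqP; rewrite -subr_eq0; apply/eqP/q_epi.
  by rewrite composeBl bq cq subrr.
- move=> K0 W a; rewrite -composeA => vga.
  have [x xE] := triangle_lift uvw vga.
  have [|b ->] := triangle_lift (y := a) fgh; last by exists b.
  by rewrite xE [x]hom_to0 ?compose0r //; apply: shift_zero.
- move=> Q0 W a ak.
  have [|c cE] := triangle_extend (y := fmap S a ∘ h) uvw.
    by rewrite -composeA -kE -fmap_comp ak shift0.
  have [|y yE] := triangle_extend3 (w := fmap S a) fgh.
    by rewrite cE [c]hom_from0 ?compose0l.
  have [b bE] := shift_full y; exists b; apply: shift_inj.
  by rewrite fmap_comp bE yE.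
- move=> W a W0; rewrite -composeA => vga.
  have [x xE] := triangle_lift uvw vga.
  have [|b ->] := triangle_lift (y := a) fgh; last by exists b.
  by rewrite xE [x]W0 compose0r.
Qed.

End HeartCone.
End Heart.

(** * The heart is abelian *)

Section HeartAbelian.
Variables (T : triangulated_category) (t : t_structure T).
Notation S := (shift_functor T).
Notation H := (heart t).
(* The same type as the morphisms of the heart, but with the additive structure
   of T. *)
Notation hom A B := (Mor (sval A) (sval B)).

Lemma heart_zero : exists Z : H, idm (sval Z) = 0.
Proof.
have [O O0] := zero_object T.
have [Z [a [b [ba ab]]]] : exists Z : H, isomorphic O (sval Z).
  by apply: heart_repr => V f _; [apply: hom_from0 | apply: hom_to0].
by exists Z; rewrite -ab (hom_from0 a O0) compose0l.
Qed.

Lemma is_zero_object_heart (Z : H) : is_zero_object Z <-> idm (sval Z) = 0.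
Proof.
split=> [[ZX _]|Z0].
  by have [f [_ fu]] := ZX Z; rewrite -[LHS](fu (idm (sval Z) : hom Z Z)) ?(fu (0 : hom Z Z)).
split=> X; exists (0 : T.(Defs.Mor) _ _); split=> // f _; apply/esym.
  exact: hom_from0.
exact: hom_to0.
Qed.

Lemma is_zero_morphism_heart (A B : H) (f : Mor A B) :
  is_zero_morphism f <-> f = 0 :> hom A B.
Proof.
split=> [[Z [/is_zero_object_heart Z0 [a [b ->]]]]|f0].
  change ((b : hom Z B) ∘ (a : hom A Z) = 0).
  by rewrite (hom_from0 b Z0) compose0l.
have [Z Z0] := heart_zero; exists Z; split; first exact/is_zero_object_heart.
exists (0 : hom A Z), (0 : hom Z B); rewrite f0.
by apply/esym/(@compose0l T).
Qed.

Lemma monomorphism_heart (A B : H) (f : Mor A B) :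
  monomorphism f <-> forall (W : H) (a : hom W A), (f : hom A B) ∘ a = 0 -> a = 0.
Proof.
split=> [fm W a fa|fm W a b fab].
  by apply: (fm W a (0 : hom W A)); rewrite /= fa (@compose0r T).
apply/eqP; rewrite -(@subr_eq0 (Mor (sval W) (sval A))); apply/eqP/fm.
by rewrite composeBr; apply/eqP; rewrite subr_eq0; apply/eqP.
Qed.

Lemma epimorphism_heart (A B : H) (f : Mor A B) :
  epimorphism f <-> forall (W : H) (a : hom B W), a ∘ (f : hom A B) = 0 -> a = 0.
Proof.
split=> [fm W a fa|fm W a b fab].
  by apply: (fm W a (0 : hom B W)); rewrite /= fa (@compose0l T).
apply/eqP; rewrite -(@subr_eq0 (Mor (sval B) (sval W))); apply/eqP/fm.
by rewrite composeBl; apply/eqP; rewrite subr_eq0; apply/eqP.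
Qed.

Lemma heart_biproduct (A B : H) :
  exists (X : H) (i : hom A X) (j : hom B X) (p : hom X A) (q : hom X B),
  [/\ p ∘ i = idm _, q ∘ j = idm _, p ∘ j = 0, q ∘ i = 0 & i ∘ p + j ∘ q = idm _].
Proof.
have [X [i [j [p [q [pi [qj [pj [qi ijpq]]]]]]]]] := biproducts (sval A) (sval B).
have [||Y [a [b [ba ab]]]] := @heart_repr T t X.
- move=> V f cV; rewrite -[f]compose_idr -ijpq composeDr !composeA.
  have [lA lB] := (heart_aisle_closure (svalP A), heart_aisle_closure (svalP B)).
  by rewrite (lA V (f ∘ i)) // (lB V (f ∘ j)) // !compose0l addr0.
- move=> U f lU; rewrite -[f]compose_idl -ijpq composeDl -!composeA.
  have [rA rB] := (heart_shifted_coaisle (svalP A), heart_shifted_coaisle (svalP B)).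
  by rewrite (rA U (p ∘ f)) // (rB U (q ∘ f)) // !compose0r addr0.
have bak Z (k : Mor Z X) : b ∘ (a ∘ k) = k by rewrite composeA ba compose_idl.
exists Y, (a ∘ i), (a ∘ j), (p ∘ b), (q ∘ b); split; rewrite -?composeA ?bak //.
by rewrite -composeDr !composeA -composeDl ijpq compose_idl ab.
Qed.

Theorem heart_abelian : abelian_category H.
Proof.
split; last split; last split; last split; last split; last split.
- by have [Z Z0] := heart_zero; exists Z; apply/is_zero_object_heart.
- move=> A B; have [X [i [j [p [q [pi qj pj qi ijpq]]]]]] := heart_biproduct A B.
  exists X, p, q => W a b; exists ((i : hom A X) ∘ (a : hom W A) + j ∘ (b : hom W B)).
  split=> [|c [<- <-]].
    split=> /=; rewrite composeDr !composeA ?pi ?qj ?pj ?qi.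
      by rewrite compose_idl compose0l addr0.
    by rewrite compose_idl compose0l add0r.
  by rewrite /= !composeA -composeDl ijpq compose_idl.
- move=> A B; have [X [i [j [p [q [pi qj pj qi ijpq]]]]]] := heart_biproduct A B.
  exists X, i, j => W a b; exists ((a : hom A W) ∘ p + (b : hom B W) ∘ q).
  split=> [|c [<- <-]].
    split=> /=; rewrite composeDl -!composeA ?pi ?qj ?pj ?qi.
      by rewrite compose_idr compose0r addr0.
    by rewrite compose_idr compose0r add0r.
  by rewrite /= -!composeA -composeDr ijpq compose_idr.
- move=> A B f; have [K [Q [k [q [[fk kP] _ _ _ _]]]]] := heart_ker_coker f.
  exists K, k; split; first exact/is_zero_morphism_heart.
  by move=> W a /is_zero_morphism_heart /kP.
- move=> A B f; have [K [Q [k [q [_ [qf qP] _ _ _]]]]] := heart_ker_coker f.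
  exists Q, q; split; first exact/is_zero_morphism_heart.
  by move=> W a /is_zero_morphism_heart /qP.
- move=> A B f f_mono.
  have [K [Q [k [q [[fk kP] [qf _] kerq _ _]]]]] := heart_ker_coker f.
  have k0 : k = 0 by apply: ((monomorphism_heart f).1 f_mono).
  have K0 : idm (sval K) = 0.
    have [b [_ bu]] := kP K 0 (compose0r _ _).
    by rewrite -[LHS]bu ?k0 ?compose0l // -[RHS]bu ?k0 ?compose0l.
  exists Q, q; split; first exact/is_zero_morphism_heart.
  move=> W a /is_zero_morphism_heart qa; have [b fb] := kerq K0 _ (a : hom W B) qa.
  by exists b; split=> // c fc; apply: f_mono; exact: etrans fb (esym fc).
- move=> A B f f_epi.
  have [K [Q [k [q [[fk _] [qf qP] _ cokerk _]]]]] := heart_ker_coker f.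
  have q0 : q = 0 by apply: ((epimorphism_heart f).1 f_epi).
  have Q0 : idm (sval Q) = 0.
    have [b [_ bu]] := qP Q 0 (compose0l _ _).
    by rewrite -[LHS]bu ?q0 ?compose0r // -[RHS]bu ?q0 ?compose0r.
  exists K, k; split; first exact/is_zero_morphism_heart.
  move=> W a /is_zero_morphism_heart ak; have [b bf] := cokerk Q0 _ (a : hom A W) ak.
  by exists b; split=> // c cf; apply: f_epi; exact: etrans bf (esym cf).
Qed.

(** A map P -> S A classifies an extension A -> E -> P. Its middle term is in the
heart and E -> P is an epimorphism there, so it splits and the map vanishes. *)
Lemma projective_ext0 (P : H) : is_projective P ->
  forall (A : H) (f : Mor (sval P) (S (sval A))), f = 0.
Proof.
move=> Pproj A f; have [E [e [d edf]]] := triangle_cocone f.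
have [a' a'E] := shift_full d; pose a := - a'.
have tri : triangle a e f.
  by apply/triangle_rot; rewrite -[a]sub0r shiftB shift0 sub0r opprK a'E.
have [lP rP] := (heart_aisle_closure (svalP P), heart_shifted_coaisle (svalP P)).
have [lA rA] := (heart_aisle_closure (svalP A), heart_shifted_coaisle (svalP A)).
have [||X [b [b' [b'b bb']]]] := @heart_repr T t E.
- move=> V g cV; have [|y ->] := triangle_extend (y := g) tri; first exact: lA.
  by rewrite (lP V y cV) compose0l.
- move=> U g lU; have [|y ->] := triangle_lift (y := g) tri; first exact: rP.
  by rewrite (rA U y lU) compose0r.
have e_epi : @epimorphism H X P (e ∘ b').
  apply/epimorphism_heart => W c ceb.
  have [|y ->] := triangle_extend2 (z := c) tri.
    by rewrite -[_ ∘ e]compose_idr -b'b composeA -[c ∘ e ∘ b']composeA ceb compose0l.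
  by rewrite (heart_shifted_coaisle (svalP W) y lA) compose0l.
have [s sE] := Pproj _ _ (e ∘ b' : @Mor H X P) (idm P) e_epi.
rewrite -[f]compose_idr -[idm _]sE /=.
by rewrite !composeA (triangle_comp0_2 tri) !compose0l.
Qed.

End HeartAbelian.

(** * Equivalences and abelian categories *)

Section FullyFaithful.
Variables (C D : category) (F : functor C D).
Hypotheses (F_full : full F) (F_faithful : faithful F)
  (F_surj : essentially_surjective F).

Let qobj Y : C := sval (cid (F_surj Y)).
Let qiso Y : Mor (F (qobj Y)) Y := sval (cid (svalP (cid (F_surj Y)))).
Let qisoP Y : is_iso (qiso Y). Proof. exact: svalP (cid (svalP (cid (F_surj Y)))). Qed.
Let qinv Y : Mor Y (F (qobj Y)) := sval (cid (qisoP Y)).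
Let qinvK Y : qinv Y ∘ qiso Y = idm _. Proof. by rewrite /qinv; case: cid => ? []. Qed.
Let qisoK Y : qiso Y ∘ qinv Y = idm _. Proof. by rewrite /qinv; case: cid => ? []. Qed.
Let qmap Y Y' (h : Mor Y Y') : Mor (qobj Y) (qobj Y') :=
  sval (cid (F_full (qinv Y' ∘ h ∘ qiso Y))).
Let qmapE Y Y' (h : Mor Y Y') : fmap F (qmap h) = qinv Y' ∘ h ∘ qiso Y.
Proof. by rewrite /qmap; case: cid. Qed.

Definition quasi_inverse : functor D C.
Proof.
apply: (@Functor D C qobj qmap) => [Y|X Y Z g f]; apply: F_faithful.
  by rewrite qmapE fmap_id compose_idr qinvK.
rewrite fmap_comp !qmapE -!composeA; congr (_ ∘ (_ ∘ _)).
by rewrite !composeA qisoK compose_idl.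
Defined.

Lemma fully_faithful_equivalence : is_equivalence F.
Proof.
exists quasi_inverse; split.
  exists (fun X => sval (cid (F_full (qiso (F X))))); split=> [X|X Y f].
    case: cid => s /= sE; have [s' s'E] := F_full (qinv (F X)).
    exists s'; split; apply: F_faithful; rewrite fmap_comp fmap_id sE s'E.
      exact: qinvK.
    exact: qisoK.
  apply: F_faithful; rewrite !fmap_comp; case: cid => s /= ->; case: cid => s' /= ->.
  by rewrite qmapE !composeA qisoK compose_idl.
exists qiso; split=> [Y|X Y f]; first exact: qisoP.
by rewrite /= qmapE !composeA qisoK compose_idl.
Qed.

End FullyFaithful.

Lemma equivalence_inverse (C D : category) (F : functor C D) :
  is_equivalence F -> exists G : functor D C, is_equivalence G.
Proof. by move=> [G [t t']]; exists G, F. Qed.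

Section ZeroMorphisms.
Variable C : category.
Implicit Types X Y Z : C.

Lemma zero_morphism_compr X Y Z (f : Mor Y Z) (g : Mor X Y) :
  is_zero_morphism f -> is_zero_morphism (f ∘ g).
Proof.
move=> [O [OO [a [b ->]]]]; exists O; split=> //.
by exists (a ∘ g), b; rewrite composeA.
Qed.

Lemma zero_morphism_compl X Y Z (f : Mor Y Z) (g : Mor X Y) :
  is_zero_morphism g -> is_zero_morphism (f ∘ g).
Proof.
move=> [O [OO [a [b ->]]]]; exists O; split=> //.
by exists a, (f ∘ b); rewrite composeA.
Qed.

Lemma zero_object_iso Z Z' : isomorphic Z Z' -> is_zero_object Z -> is_zero_object Z'.
Proof.
move=> [a [b [ba ab]]] [Z1 Z2]; split=> X.
  have [f [_ fu]] := Z1 X; exists (f ∘ b); split=> // g _.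
  by rewrite (fu (g ∘ a)) // -composeA ab compose_idr.
have [f [_ fu]] := Z2 X; exists (a ∘ f); split=> // g _.
by rewrite (fu (b ∘ g)) // composeA ab compose_idl.
Qed.

Lemma kernel_isor K K' X Y (f : Mor X Y) (k : Mor K X) (a : Mor K' K) :
  is_iso a -> is_kernel f k -> is_kernel f (k ∘ a).
Proof.
move=> [b [ba ab]] [fk kP]; split; first by rewrite composeA; apply: zero_morphism_compr.
move=> W c /kP[d [kd du]]; exists (b ∘ d); split=> [|e kae].
  by rewrite -composeA [a ∘ _]composeA ab compose_idl.
by rewrite (du (a ∘ e)) ?composeA // ba compose_idl.
Qed.

Lemma kernel_isol K X Y Y' (f : Mor X Y) (k : Mor K X) (a : Mor Y Y') :
  is_iso a -> is_kernel f k -> is_kernel (a ∘ f) k.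
Proof.
move=> [b [ba ab]] [fk kP]; split; first by rewrite -composeA; apply: zero_morphism_compl.
move=> W c afc; apply: kP; have -> : f ∘ c = b ∘ (a ∘ f ∘ c).
  by rewrite !composeA ba compose_idl.
exact: zero_morphism_compl.
Qed.

Lemma cokernel_isol Q Q' X Y (f : Mor X Y) (q : Mor Y Q) (a : Mor Q Q') :
  is_iso a -> is_cokernel f q -> is_cokernel f (a ∘ q).
Proof.
move=> [b [ba ab]] [qf qP]; split; first by rewrite -composeA; apply: zero_morphism_compl.
move=> W c /qP[d [dq du]]; exists (d ∘ b); split=> [|e eaq].
  by rewrite -composeA [b ∘ _]composeA ba compose_idl.
by rewrite (du (e ∘ a)) -?composeA // ab compose_idr.
Qed.

Lemma cokernel_isor Q X X' Y (f : Mor X Y) (q : Mor Y Q) (a : Mor X' X) :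
  is_iso a -> is_cokernel f q -> is_cokernel (f ∘ a) q.
Proof.
move=> [b [ba ab]] [qf qP]; split; first by rewrite composeA; apply: zero_morphism_compr.
move=> W c cfa; apply: qP; have -> : c ∘ f = c ∘ (f ∘ a) ∘ b.
  by rewrite -!composeA ab compose_idr.
exact: zero_morphism_compr.
Qed.

End ZeroMorphisms.

Section AbelianTransfer.
Variables (D C : category) (G : functor D C).
Hypothesis Geq : is_equivalence G.
Let G_full := equivalence_full Geq.
Let G_faithful := equivalence_faithful Geq.
Let G_surj := equivalence_essentially_surjective Geq.

Lemma reflect_zero_object Z : is_zero_object (G Z) <-> is_zero_object Z.
Proof.
split=> [] [Z1 Z2]; split=> X.
- have [f [_ fu]] := Z1 (G X); have [g gf] := G_full f.
  by exists g; split=> // h _; apply: G_faithful; rewrite gf; apply: fu.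
- have [f [_ fu]] := Z2 (G X); have [g gf] := G_full f.
  by exists g; split=> // h _; apply: G_faithful; rewrite gf; apply: fu.
- have [X' [a [b [ba ab]]]] := G_surj X; have [f [_ fu]] := Z1 X'.
  exists (a ∘ fmap G f); split=> // h _; have [h' h'E] := G_full (b ∘ h).
  by rewrite (fu h') // h'E composeA ab compose_idl.
- have [X' [a [b [ba ab]]]] := G_surj X; have [f [_ fu]] := Z2 X'.
  exists (fmap G f ∘ b); split=> // h _; have [h' h'E] := G_full (h ∘ a).
  by rewrite (fu h') // h'E -composeA ab compose_idr.
Qed.

Lemma reflect_zero_morphism X Y (f : Mor X Y) :
  is_zero_morphism (fmap G f) <-> is_zero_morphism f.
Proof.
split=> [[Z [Z0 [a [b fE]]]]|[Z [/reflect_zero_object Z0 [a [b ->]]]]]; last first.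
  by exists (G Z); split=> //; exists (fmap G a), (fmap G b); rewrite fmap_comp.
have [Z' [c [d [dc cd]]]] := G_surj Z.
have [a' a'E] := G_full (d ∘ a); have [b' b'E] := G_full (b ∘ c).
exists Z'; split.
  by apply/reflect_zero_object; apply: zero_object_iso Z0; exists d, c.
exists a', b'; apply: G_faithful; rewrite fmap_comp a'E b'E fE.
by rewrite -composeA [c ∘ _]composeA cd compose_idl.
Qed.

Lemma reflect_kernel K X Y (f : Mor X Y) (k : Mor K X) :
  is_kernel (fmap G f) (fmap G k) -> is_kernel f k.
Proof.
move=> [fk kP]; split; first by apply/reflect_zero_morphism; rewrite fmap_comp.
move=> W a fa; have [|b [kb bu]] := kP _ (fmap G a).
  by rewrite -fmap_comp; apply/reflect_zero_morphism.
have [b' b'E] := G_full b; exists b'; split=> [|c kc].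
  by apply: G_faithful; rewrite fmap_comp b'E.
by apply: G_faithful; rewrite b'E; apply: bu; rewrite -kc fmap_comp.
Qed.

Lemma reflect_cokernel Q X Y (f : Mor X Y) (q : Mor Y Q) :
  is_cokernel (fmap G f) (fmap G q) -> is_cokernel f q.
Proof.
move=> [qf qP]; split; first by apply/reflect_zero_morphism; rewrite fmap_comp.
move=> W a af; have [|b [bq bu]] := qP _ (fmap G a).
  by rewrite -fmap_comp; apply/reflect_zero_morphism.
have [b' b'E] := G_full b; exists b'; split=> [|c cq].
  by apply: G_faithful; rewrite fmap_comp b'E.
by apply: G_faithful; rewrite b'E; apply: bu; rewrite -cq fmap_comp.
Qed.

Lemma preserve_mono X Y (f : Mor X Y) : monomorphism f -> monomorphism (fmap G f).
Proof.
move=> f_mono Z a b fab; have [Z' [c c_iso]] := G_surj Z.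
apply: (iso_epi c_iso); have [a' a'E] := G_full (a ∘ c); have [b' b'E] := G_full (b ∘ c).
rewrite -a'E -b'E; congr (fmap G _); apply: f_mono; apply: G_faithful.
by rewrite !fmap_comp a'E b'E !composeA fab.
Qed.

Lemma preserve_epi X Y (f : Mor X Y) : epimorphism f -> epimorphism (fmap G f).
Proof.
move=> f_epi Z a b fab; have [Z' [c' [c [cc' c'c]]]] := G_surj Z.
apply: (@iso_mono _ _ _ c); first by exists c'.
have [a' a'E] := G_full (c ∘ a); have [b' b'E] := G_full (c ∘ b).
rewrite -a'E -b'E; congr (fmap G _); apply: f_epi; apply: G_faithful.
by rewrite !fmap_comp a'E b'E -!composeA fab.
Qed.

(** Each universal object is built in C and replaced by an isomorphic one in the
image of G, where its universal property is reflected. *)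
Theorem abelian_transfer : abelian_category C -> abelian_category D.
Proof.
move=> [zeroC [prodC [coprodC [kerC [cokerC [monoC epiC]]]]]].
split; last split; last split; last split; last split; last split.
- have [Z Z0] := zeroC; have [Z' /isomorphic_sym Z'Z] := G_surj Z; exists Z'.
  by apply/reflect_zero_object; apply: zero_object_iso Z0.
- move=> X Y; have [B [p [q pqP]]] := prodC (G X) (G Y).
  have [B' [a [a' [a'a aa']]]] := G_surj B.
  have [p' p'E] := G_full (p ∘ a); have [q' q'E] := G_full (q ∘ a).
  exists B', p', q' => W x y; have [c [[pc qc] cu]] := pqP _ (fmap G x) (fmap G y).
  have [c' c'E] := G_full (a' ∘ c); exists c'; split=> [|d [p'd q'd]].
    split; apply: G_faithful; rewrite fmap_comp c'E ?p'E ?q'E -composeA.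
      by rewrite [a ∘ _]composeA aa' compose_idl.
    by rewrite [a ∘ _]composeA aa' compose_idl.
  apply: G_faithful; rewrite c'E (cu (a ∘ fmap G d)).
    by rewrite composeA a'a compose_idl.
  by rewrite !composeA -p'E -q'E -!fmap_comp p'd q'd.
- move=> X Y; have [B [p [q pqP]]] := coprodC (G X) (G Y).
  have [B' [a [a' [a'a aa']]]] := G_surj B.
  have [p' p'E] := G_full (a' ∘ p); have [q' q'E] := G_full (a' ∘ q).
  exists B', p', q' => W x y; have [c [[pc qc] cu]] := pqP _ (fmap G x) (fmap G y).
  have [c' c'E] := G_full (c ∘ a); exists c'; split=> [|d [p'd q'd]].
    split; apply: G_faithful; rewrite fmap_comp c'E ?p'E ?q'E -composeA.
      by rewrite [a ∘ _]composeA aa' compose_idl.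
    by rewrite [a ∘ _]composeA aa' compose_idl.
  apply: G_faithful; rewrite c'E (cu (fmap G d ∘ a')).
    by rewrite -composeA a'a compose_idr.
  by rewrite -!composeA -p'E -q'E -!fmap_comp p'd q'd.
- move=> X Y f; have [K [k kP]] := kerC _ _ (fmap G f).
  have [K' [a a_iso]] := G_surj K; have [k' k'E] := G_full (k ∘ a).
  by exists K', k'; apply: reflect_kernel; rewrite k'E; apply: kernel_isor.
- move=> X Y f; have [Q [q qP]] := cokerC _ _ (fmap G f).
  have [Q' /isomorphic_sym[a a_iso]] := G_surj Q; have [q' q'E] := G_full (a ∘ q).
  by exists Q', q'; apply: reflect_cokernel; rewrite q'E; apply: cokernel_isol.
- move=> X Y f /preserve_mono/monoC[Z [g gP]].
  have [Z' /isomorphic_sym[a a_iso]] := G_surj Z; have [g' g'E] := G_full (a ∘ g).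
  by exists Z', g'; apply: reflect_kernel; rewrite g'E; apply: kernel_isol.
- move=> X Y f /preserve_epi/epiC[Z [g gP]].
  have [Z' [a a_iso]] := G_surj Z; have [g' g'E] := G_full (g ∘ a).
  by exists Z', g'; apply: reflect_cokernel; rewrite g'E; apply: cokernel_isor.
Qed.

End AbelianTransfer.

(** * The equivalence between the heart and the contramodules *)

Lemma contra_bijective_iso (R : complete_topRing) (C D : Ctra R) (f : Mor C D) :
  (forall c c', sval f c = sval f c' -> c = c') ->
  (forall d, exists c, sval f c = d) -> is_iso f.
Proof.
move=> f_inj f_surj; pose g d := sval (cid (f_surj d)).
have fg d : sval f (g d) = d by rewrite /g; case: cid.
have gP : contra_morphism g.
  move=> u; apply: f_inj; rewrite fg (svalP f) -lincomb_map_comp.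
  have -> : sval f \o g = id by apply/funext => d; apply: fg.
  by rewrite lincomb_map_id.
exists (exist _ g gP); split; apply: contra_hom_inj; apply/funext => x /=.
  by apply: f_inj; rewrite fg.
exact: fg.
Qed.

Section HomEquivalence.
Variables (T : triangulated_category) (cop : has_coproducts T) (t : t_structure T).
Hypothesis cg : compactly_generated T.
Variable P : heart t.
Hypothesis projgen : is_projective_generator P.
Hypothesis DefP : forall X : T, Def (sval P) X -> in_heart t X.
Variable cs : complete_ring (compact_topology (sval P)) /\
  separated_ring (compact_topology (sval P)).
Notation CR := (CompleteTopRing cs).
Notation hom A B := (Mor (sval A) (sval B)).
Let aP : aisle t (sval P) := proj1 (svalP P).
Notation power := (copower cop (sval P)).
Notation lift := (of_lincomb cop cg aP DefP (cs := cs)).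
Notation expand := (to_lincomb (cop:=cop) cs).

Let laws (X : heart t) := hom_contraact_laws cop cg aP DefP cs (sval X).
Let morphisms (X Y : heart t) (f : Mor X Y) : contra_morphism (hom_map laws f) :=
  fun u => hom_contraact_morphism cop cg aP DefP f u.
Let F := hom_functor morphisms.

Let lift_of_expand (Z : small) (phi : Mor (sval P) (power Z)) :
  lift (expand phi) = phi.
Proof. exact: to_lincombK. Qed.

Let expand_of_lift (Z : small) (u : lincomb CR Z) : expand (lift u) = u.
Proof. by apply: lincomb_inj => z /=; rewrite of_lincombK. Qed.

Definition heart_power (Z : small) : heart t :=
  exist _ (power Z : T) (DefP (definable_hull_Def (@copower_definable_hull T cop (sval P) Z))).

Lemma generator_ext (X Y : heart t) (f g : hom X Y) :
  (forall h : hom P X, f ∘ h = g ∘ h) -> f = g.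
Proof. exact: projgen.2. Qed.

Lemma evaluation_map X (Z : small) (f : Z -> Mor (sval P) X) :
  evaluation cop (sval P) X ∘ copower_map cop (sval P) f = cp_case (power Z) f.
Proof. by apply: coproduct_ext => z; rewrite -composeA !cp_caseK. Qed.

Lemma contraact_map (X : heart t) (Z : small) (f : Z -> hom P X) (u : lincomb CR Z) :
  hom_contraact cop cs (sval X) (lincomb_map f u) = cp_case (power Z) f ∘ lift u.
Proof.
by rewrite (hom_contraactE cop cg aP DefP) of_lincomb_map composeA evaluation_map.
Qed.

Lemma hom_faithful : faithful F.
Proof.
move=> X Y f g fg; apply: generator_ext => h.
exact: (congr1 (fun k : hom P X -> hom P Y => k h) (congr1 (@proj1_sig _ _) fg)).
Qed.

(** The evaluation is an epimorphism in the heart since P is a generator. *)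
Lemma evaluation_coker (X : heart t) : exists (K : heart t) (k : hom K (heart_power (hom P X))),
  evaluation cop (sval P) (sval X) ∘ k = 0 /\
  forall (W : heart t) (a : hom (heart_power (hom P X)) W), a ∘ k = 0 ->
    exists b, b ∘ evaluation cop (sval P) (sval X) = a.
Proof.
pose ev : hom (heart_power (hom P X)) X := evaluation cop (sval P) (sval X).
have [K [Q [k [q [[fk _] [qf qP] _ cokerk _]]]]] := heart_ker_coker ev.
exists K, k; split=> //; apply: cokerk.
have q0 : q = 0.
  apply: generator_ext => h; rewrite compose0l.
  have := congr1 (fun m => m ∘ cp_inj (power (hom P X)) h) qf.
  by rewrite compose0l -composeA cp_caseK.
have [b [_ bu]] := qP Q 0 (compose0l _ _).
by rewrite -[LHS]bu ?q0 ?compose0r // -[RHS]bu ?q0 ?compose0r.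
Qed.

(** A contramodule morphism phi defines psi on P^(Hom(P, X)), and compatibility
with infinite sums says that psi x = phi (ev x) for all x : P -> P^(Hom(P, X)).
So psi kills the kernel of the evaluation and descends to X. *)
Lemma hom_full : full F.
Proof.
move=> X Y [phi phiP]; have [K [k [evk coker]]] := evaluation_coker X.
pose psi : hom (heart_power (hom P X)) Y := cp_case (power (hom P X)) phi.
have psiE (x : Mor (sval P) (power (hom P X))) :
    psi ∘ x = phi (evaluation cop (sval P) (sval X) ∘ x).
  have := phiP (expand x); rewrite /= contraact_map.
  by rewrite (hom_contraactE cop cg aP DefP) lift_of_expand => <-.
have [|b bE] := coker Y psi.
  apply: generator_ext => p; rewrite compose0l -composeA psiE composeA evk compose0l.
  by rewrite -(compose0r _ (evaluation cop (sval P) (sval X))) -psiE compose0r.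
exists b; apply: contra_hom_inj; apply/funext => h /=.
rewrite /hom_map /= -[h in LHS](cp_caseK (power (hom P X)) id).
rewrite composeA bE.
exact: cp_caseK.
Qed.

(** A contramodule is a mere set with a contraaction. That whether two maps
P -> P^(C) have the same value in C depends on their difference only
([combine_sub]) is a consequence of the associativity of the contraaction. *)
Section EssentialSurjectivity.
Variable C : contramodule CR.

(** The contraaction of C, read on the free contramodule Hom(P, P^(C)). *)
Definition combine (x : Mor (sval P) (power C)) : C := contraact (expand x).

(** Associativity of the contraaction, applied to the infinite sum of the columns
of m with coefficients w. *)
Lemma combine_comp (Y : small) (m : Mor (power Y) (power C)) (w : Mor (sval P) (power Y)) :
  combine (m ∘ w) =
  contraact (lincomb_map (fun y => combine (m ∘ cp_inj (power Y) y)) (expand w)).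
Proof.
have [_ actM] := contraactP C.
pose w' := lincomb_map (fun y => expand (m ∘ cp_inj (power Y) y)) (expand w).
have mwE : expand (m ∘ w) = lincomb_mul w'.
  rewrite -[RHS]expand_of_lift of_lincomb_mul of_lincomb_map lift_of_expand.
  congr (expand _); rewrite composeA; congr (_ ∘ _); apply: coproduct_ext => y.
  by rewrite -!composeA !cp_caseK lift_of_expand.
by rewrite {1}/combine mwE actM -lincomb_map_comp.
Qed.

Lemma combine_ext (Y : small) (m m' : Mor (power Y) (power C)) w :
  (forall y, combine (m ∘ cp_inj (power Y) y) = combine (m' ∘ cp_inj (power Y) y)) ->
  combine (m ∘ w) = combine (m' ∘ w).
Proof. by move=> /funext mm'; rewrite combine_comp mm' -combine_comp. Qed.

Lemma combine_inj c : combine (cp_inj (power C) c) = c.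
Proof.
have [act1 _] := contraactP C; rewrite -[RHS]act1 /combine; congr contraact.
by rewrite -(of_lincomb_unit cop cg aP DefP) expand_of_lift.
Qed.

(** A sum of two maps is the composite of their pair with the diagonal of P, which
is a map to a copower over two elements. *)
Lemma combine_add x x' y : combine x = combine x' -> combine (x + y) = combine (x' + y).
Proof.
move=> xx'; pose m z := cp_case (power bool) (fun b : bool => if b then z else y).
pose w := cp_inj (power bool) true + cp_inj (power bool) false.
have mw z : m z ∘ w = z + y by rewrite composeDr !cp_caseK.
by rewrite -!mw; apply: combine_ext => -[]; rewrite !cp_caseK.
Qed.

Lemma combine_sub x x' : combine x = combine x' <-> combine (x - x') = combine 0.
Proof.
split=> [/(combine_add (- x'))|/(combine_add x')]; first by rewrite subrr.
by rewrite subrK add0r.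
Qed.

(** Q is the cokernel of P^(N) -> P^(C), where N is the set of all maps evaluated
by C like 0. By exactness two maps P -> P^(C) agree in Q iff C evaluates them
equally, so c |-> q c is injective; projectivity of P makes it surjective. *)
Lemma hom_essentially_surjective_at : exists X : heart t, isomorphic (F X) C.
Proof.
pose N : small := {x : Mor (sval P) (power C) | combine x = combine 0}.
pose m : hom (heart_power N) (heart_power C) := cp_case (power N) (fun n : N => sval n).
have [K [Q [k [q [_ [qm qP] _ _ exact_q]]]]] := heart_ker_coker m.
have qE x x' : q ∘ x = q ∘ x' <-> combine x = combine x'.
  rewrite combine_sub; split=> [qxx'|Nx].
    have [||b <-] := exact_q _ (x - x').
    - exact: (projective_ext0 projgen.1).
    - by rewrite composeBr qxx' subrr.
    rewrite -(compose0l (power C) b); apply: combine_ext => n.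
    by rewrite cp_caseK compose0l; apply: svalP n.
  apply/eqP; rewrite -subr_eq0 -composeBr; apply/eqP.
  pose n : N := exist _ (x - x') Nx.
  have := congr1 (fun k => k ∘ cp_inj (power N) n) qm.
  by rewrite compose0l -composeA cp_caseK.
have q_epi : @epimorphism (heart t) (heart_power C) Q q.
  apply/epimorphism_heart => W a aq.
  have [b [_ bu]] := qP W 0 (compose0l _ _).
  by rewrite -[LHS]bu // -[RHS]bu // compose0l.
pose phi : C -> hom P Q := fun c => q ∘ cp_inj (power C) c.
have phi_case : cp_case (power C) phi = q.
  by apply: coproduct_ext => c; rewrite cp_caseK.
have phiP : @contra_morphism _ C (F Q) phi.
  move=> u; rewrite /= contraact_map phi_case; apply/qE.
  by rewrite combine_inj /combine expand_of_lift.
exists Q; apply: isomorphic_sym; exists (exist _ phi phiP : @Mor (Ctra _) C (F Q)).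
apply: contra_bijective_iso => [c c' /qE|y] /=; first by rewrite !combine_inj.
have [x xE] := projgen.1 _ _ _ (y : @Mor (heart t) P Q) q_epi.
exists (combine x); rewrite -[RHS]xE; apply/qE.
by rewrite combine_inj.
Qed.

End EssentialSurjectivity.

Theorem hom_equivalence : is_equivalence F.
Proof.
apply: fully_faithful_equivalence hom_full hom_faithful _ => C.
exact: hom_essentially_surjective_at.
Qed.

Theorem Ctra_abelian : abelian_category (Ctra CR).
Proof.
have [G Geq] := equivalence_inverse hom_equivalence.
exact: abelian_transfer Geq (heart_abelian t).
Qed.

End HomEquivalence.

Theorem proposition2p7 (T : triangulated_category) (cop : has_coproducts T)
    (cg : compactly_generated T) (t : t_structure T)
    (P : heart t) (projgen : is_projective_generator P)
    (DefP : forall X : T, Def (sval P) X -> in_heart t X) :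
  exists cs : complete_ring (compact_topology (sval P)) /\
              separated_ring (compact_topology (sval P)),
    (forall Z : small,
       set_bij setT [set r | zero_convergent r]%classic
         (@coordinates T cop (sval P) Z)) /\
    exists (laws : forall X : heart t,
              contramodule_laws (hom_contraact cop cs (sval X)))
           (morphisms : forall (X Y : heart t) (f : Mor X Y),
              contra_morphism (hom_map laws f)),
      abelian_category (heart t) /\
      abelian_category (Ctra (CompleteTopRing cs)) /\
      is_equivalence (hom_functor morphisms).
Proof.
have aP : aisle t (sval P) := proj1 (svalP P).
exists (conj (endo_complete cop cg aP DefP) (endo_separated cop cg aP DefP)).
split; first by move=> Z; exact: (coordinates_bij cop cg aP DefP Z).
eexists; eexists; split; first exact: heart_abelian.
split; first exact: (Ctra_abelian cop cg projgen DefP).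
exact: (hom_equivalence cop cg projgen DefP).
Qed.
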